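(* Let $\mu=(\mu_1,\dots,\mu_k)$ be a vector of Borel probability measures on $\mathbb{R}^d$ and let $q\in\mathbb{R}^k$ be fixed. Let $t_q\in\mathbb{R}$, $r_q>0$, $\underline{K}_q,\overline{K}_q>0$, let $\nu_q$ be a Borel probability measure supported by $\mathrm{Support}(\mu)$, and let $\varphi_q:\mathbb{R}_+\to\mathbb{R}$ satisfy $\varphi_q(r)=o(\log r)$ as $r\to0$. Let $(r_{q,n})_n\subset(0,1)$ be a sequence decreasing to $0$ such that $$\frac{\log r_{q,n+1}}{\log r_{q,n}}\to1\quad\text{and}\quad\sum_n r_{q,n}^{\varepsilon}<\infty\ \text{ for all }\varepsilon>0.$$ Assume: (A1) for all $x\in\mathrm{Support}(\mu)$ and $r\in(0,r_q)$, $$\underline{K}_q\le\frac{\nu_q(B(x,r))}{(\mu(B(x,r)))^q(2r)^{t_q}\exp(\varphi_q(r))}\le\overline{K}_q;$$ (A2) the limit $C_q(p)=\lim_{n\to\infty}C_{q,n}(p)$ exists and is finite for all $p\in\mathbb{R}^k$, where $$C_{q,n}(p)=\frac{1}{-\log r_{q,n}}\log\left(\int_{\mathrm{Support}(\mu)}(\mu(B(x,r_{q,n})))^p\,d\nu_q(x)\right).$$ Then: (i) if $q\in\mathbb{R}^k_-$, $$\dim\left(\underline{X}_{-\nabla_+C_q(0)}\cap\overline{X}^{-\nabla_-C_q(0)}\right)\ge-\langle\nabla_-C_q(0),q\rangle+\Lambda_\mu(q)\ge-\langle\nabla_-C_q(0),q\rangle+B_\mu(q)\ge-\langle\nabla_-C_q(0),q\rangle+b_\mu(q),$$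 and if $q\in\mathbb{R}^k_+$, $$\dim\left(\underline{X}_{-\nabla_+C_q(0)}\cap\overline{X}^{-\nabla_-C_q(0)}\right)\ge-\langle\nabla_+C_q(0),q\rangle+\Lambda_\mu(q)\ge-\langle\nabla_+C_q(0),q\rangle+B_\mu(q)\ge-\langle\nabla_+C_q(0),q\rangle+b_\mu(q).$$ (ii) If $C_q$ is differentiable at $0$, then $$f_\mu(-\nabla C_q(0))=b_\mu^*(-\nabla C_q(0))=B_\mu^*(-\nabla C_q(0))=\Lambda_\mu^*(-\nabla C_q(0)).$$
   Context: $d,k\ge1$ are integers; $B(x,r)$ is the closed ball of center $x$ and radius $r$ in $\mathbb{R}^d$. $\mathrm{Support}(\mu)$ is the set of $x\in\mathbb{R}^d$ with $\mu_j(B(x,r))>0$ for all $r>0$ and all $j=1,\dots,k$. For $p\in\mathbb{R}^k$, $(\mu(B(x,r)))^p=\prod_{j=1}^k\mu_j(B(x,r))^{p_j}$. $\mathbb{R}^k_+$ (resp. $\mathbb{R}^k_-$) is the set of vectors with all coordinates $\ge0$ (resp. $\le0$). $\dim$ is Hausdorff dimension; $\langle\cdot,\cdot\rangle$ is the Euclidean inner product. Mixed multifractal dimensions. A centered $\epsilon$-covering of $E\subseteq\mathbb{R}^d$ is a countable family of balls $B(x_i,r_i)$ with $x_i\in E$, $r_i<\epsilon$, covering $E$; a centered $\epsilon$-packing of $E$ is a countable family of pairwise disjoint balls $B(x_i,r_i)$ with $x_i\in E$, $r_i<\epsilon$. For $q\in\mathbb{R}^k$, $t\in\mathbb{R}$,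 and nonempty $E\subseteq\mathbb{R}^d$ put $\overline{\mathcal H}_{\mu,\epsilon}^{q,t}(E)=\inf\sum_i(\mu(B(x_i,r_i)))^q(2r_i)^t$ over centered $\epsilon$-coverings of $E$, $\overline{\mathcal P}_{\mu,\epsilon}^{q,t}(E)=\sup\sum_i(\mu(B(x_i,r_i)))^q(2r_i)^t$ over centered $\epsilon$-packings of $E$ (both equal $0$ for $E=\emptyset$), and $$\overline{\mathcal H}_\mu^{q,t}(E)=\lim_{\epsilon\downarrow0}\overline{\mathcal H}_{\mu,\epsilon}^{q,t}(E),\quad \mathcal H_\mu^{q,t}(E)=\sup_{F\subseteq E}\overline{\mathcal H}_\mu^{q,t}(F),$$ $$\overline{\mathcal P}_\mu^{q,t}(E)=\lim_{\epsilon\downarrow0}\overline{\mathcal P}_{\mu,\epsilon}^{q,t}(E),\quad \mathcal P_\mu^{q,t}(E)=\inf_{E\subseteq\bigcup_iE_i}\sum_i\overline{\mathcal P}_\mu^{q,t}(E_i)$$ (countable covers). Conventions: $0^s=+\infty$ for $s<0$, $0^0=1$, $0\cdot\infty=0$. With $E=\mathrm{Support}(\mu)$, $b_\mu(q)$, $B_\mu(q)$, $\Lambda_\mu(q)\in[-\infty,+\infty]$ are the unique numbers such that $\mathcal H_\mu^{q,t}(E)$, $\mathcal P_\mu^{q,t}(E)$, $\overline{\mathcal P}_\mu^{q,t}(E)$, respectively, equals $+\infty$ for $t$ below the number and $0$ for $t$ above it. Level sets. $\underline\alpha_{\mu_j}(x)=\liminf_{r\downarrow0}\frac{\log\mu_j(B(x,r))}{\log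 r}$, $\overline\alpha_{\mu_j}(x)=\limsup_{r\downarrow0}\frac{\log\mu_j(B(x,r))}{\log r}$. For $\alpha\in\mathbb{R}^k_+$: $\underline X_\alpha=\{x\in\mathrm{Support}(\mu):\underline\alpha_{\mu_j}(x)\ge\alpha_j\ \forall j\}$, $\overline X^\alpha=\{x\in\mathrm{Support}(\mu):\overline\alpha_{\mu_j}(x)\le\alpha_j\ \forall j\}$, $X(\alpha)=\underline X_\alpha\cap\overline X^\alpha$, and $f_\mu(\alpha)=\dim X(\alpha)$ is the mixed multifractal spectrum. For a convex function $C:\mathbb{R}^k\to\mathbb{R}$, $\nabla_+C(p)$ and $\nabla_-C(p)$ are the vectors of right, respectively left, partial derivatives of $C$ at $p$. For $g:\mathbb{R}^k\to[-\infty,+\infty]$, the Legendre transform is $g^*(\alpha)=\inf_{q\in\mathbb{R}^k}(\langle\alpha,q\rangle+g(q))$. *)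

(* Defs.v *)
From HB Require Import structures.
From mathcomp Require Import all_boot all_order all_algebra.
From mathcomp Require Import all_classical all_reals all_analysis.

Set Implicit Arguments.
Unset Strict Implicit.
Unset Printing Implicit Defensive.

Import Order.TTheory GRing.Theory Num.Theory.
Import numFieldNormedType.Exports.

Local Open Scope classical_set_scope.
Local Open Scope ring_scope.

(* R^n with its Borel sigma-algebra.  The topology of 'rV[R]_n is the product
   topology, but its norm in the library is the sup norm, so Euclidean
   distances and balls are defined explicitly. *)
Notation borel_space R n := (g_sigma_algebraType (@open 'rV[R]_n)).

Section euclidean.
Context {R : realType} {n : nat}.
Implicit Types (x y u v : 'rV[R]_n).

Definition inner u v : R := \sum_(i < n) u 0 i * v 0 i.

Definition edist x y : R := Num.sqrt (\sum_(i < n) (x 0 i - y 0 i) ^+ 2).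

Definition eball x (r : R) : set 'rV[R]_n := [set y | edist x y <= r].

Definition nonneg_vec : set 'rV[R]_n := [set u | forall i, 0 <= u 0 i].
Definition nonpos_vec : set 'rV[R]_n := [set u | forall i, u 0 i <= 0].

End euclidean.

Section hausdorff_dimension.
Context {R : realType} {n : nat}.
Implicit Types (A E : set 'rV[R]_n) (s delta : R).
Local Open Scope ereal_scope.

(* The maximum with 0 only matters for the empty set, whose diameter is 0. *)
Definition ediam A : \bar R :=
  maxe 0 (ereal_sup [set (edist p.1 p.2)%:E | p in A `*` A]).

(* Countable families are indexed by a subset I of nat; I may be finite or
   empty. *)
Definition hausdorff_premeasure s delta E : \bar R :=
  ereal_inf [set z | exists (I : set nat) (U : nat -> set 'rV[R]_n),
    [/\ E `<=` \bigcup_(i in I) U i,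
        forall i, I i -> ediam (U i) <= delta%:E &
        z = \esum_(i in I) poweR (ediam (U i)) s]].

Definition hausdorff_measure s E : \bar R :=
  lim (hausdorff_premeasure s delta E @[delta --> 0%R^'+]).

Definition hausdorff_dim E : \bar R :=
  ereal_inf [set s%:E | s in [set s | (0 <= s)%R /\ hausdorff_measure s E = 0]].

End hausdorff_dimension.

Section mixed_multifractal.
Context {R : realType} {d k : nat}.
Variable mu : 'I_k -> probability (borel_space R d) R.
Implicit Types (x : 'rV[R]_d) (E : set 'rV[R]_d) (q alpha : 'rV[R]_k).
Implicit Types (t s r eps : R).
Local Open Scope ereal_scope.

Definition mixed_support : set 'rV[R]_d :=
  [set x | forall (r : R) (j : 'I_k), (0 < r)%R -> 0 < mu j (eball x r)].

(* Real power of a nonnegative extended real with 0^s = +oo for s < 0; the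
   library's power has 0^s = 0 for every s <> 0. *)
Definition mass_pow (m : \bar R) s : \bar R :=
  if (m == 0) && (s < 0)%R then +oo else poweR m s.

(* mu(B(x,r))^q; the product mule of \bar R satisfies 0 * +oo = 0. *)
Definition ball_pow q x r : \bar R :=
  \big[mule/1]_(j < k) mass_pow (mu j (eball x r)) (q ord0 j).

Definition centered_covering eps E (I : set nat) (x : nat -> 'rV[R]_d)
    (r : nat -> R) : Prop :=
  (forall i, I i -> E (x i) /\ (0 < r i < eps)%R) /\
  E `<=` \bigcup_(i in I) eball (x i) (r i).

Definition centered_packing eps E (I : set nat) (x : nat -> 'rV[R]_d)
    (r : nat -> R) : Prop :=
  (forall i, I i -> E (x i) /\ (0 < r i < eps)%R) /\
  trivIset I (fun i => eball (x i) (r i)).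

Definition ball_sum q t (I : set nat) (x : nat -> 'rV[R]_d) (r : nat -> R)
    : \bar R :=
  \esum_(i in I) (ball_pow q (x i) (r i) * ((2 * r i) `^ t)%:E).

(* For E = set0 the empty family is a covering, and the only packing, so that
   both quantities below are 0. *)
Definition H_eps q t eps E : \bar R :=
  ereal_inf [set z | exists (I : set nat) (x : nat -> 'rV[R]_d) (r : nat -> R),
    centered_covering eps E I x r /\ z = ball_sum q t I x r].

Definition P_eps q t eps E : \bar R :=
  ereal_sup [set z | exists (I : set nat) (x : nat -> 'rV[R]_d) (r : nat -> R),
    centered_packing eps E I x r /\ z = ball_sum q t I x r].

Definition H_bar q t E : \bar R := lim (H_eps q t eps E @[eps --> 0%R^'+]).

Definition H_mes q t E : \bar R := ereal_sup [set H_bar q t F | F in subset^~ E].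

Definition P_bar q t E : \bar R := lim (P_eps q t eps E @[eps --> 0%R^'+]).

Definition P_mes q t E : \bar R :=
  ereal_inf [set z | exists F : nat -> set 'rV[R]_d,
    E `<=` \bigcup_i F i /\ z = \sum_(0 <= i <oo) P_bar q t (F i)].

(* At most one c satisfies is_cutoff g c, since distinct extended reals are
   separated by a real; the default value 0 is used only if there is none. *)
Definition is_cutoff (g : R -> \bar R) (c : \bar R) : Prop :=
  forall t : R, (t%:E < c -> g t = +oo) /\ (c < t%:E -> g t = 0).

Definition cutoff (g : R -> \bar R) : \bar R := xget 0 (is_cutoff g).

Definition b_dim q : \bar R := cutoff (fun t => H_mes q t mixed_support).
Definition B_dim q : \bar R := cutoff (fun t => P_mes q t mixed_support).
Definition Lambda_dim q : \bar R := cutoff (fun t => P_bar q t mixed_support).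

Definition local_ratio (j : 'I_k) x r : \bar R :=
  (ln (fine (mu j (eball x r))) / ln r)%:E.

Definition lower_local_dim (j : 'I_k) x : \bar R :=
  limf_einf (local_ratio j x) 0%R^'+.
Definition upper_local_dim (j : 'I_k) x : \bar R :=
  limf_esup (local_ratio j x) 0%R^'+.

Definition X_lower alpha : set 'rV[R]_d :=
  [set x | mixed_support x /\ forall j, (alpha ord0 j)%:E <= lower_local_dim j x].
Definition X_upper alpha : set 'rV[R]_d :=
  [set x | mixed_support x /\ forall j, upper_local_dim j x <= (alpha ord0 j)%:E].
Definition X_level alpha : set 'rV[R]_d := X_lower alpha `&` X_upper alpha.

Definition mixed_spectrum alpha : \bar R := hausdorff_dim (X_level alpha).

Definition log_moment (nu : probability (borel_space R d) R) r (p : 'rV[R]_k)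
    : \bar R :=
  ((- ln r)^-1)%:E * lne (\int[nu]_(x in mixed_support) ball_pow p x r).

End mixed_multifractal.

Section legendre_gradient.
Context {R : realType} {k : nat}.

Definition legendre (g : 'rV[R]_k -> \bar R) (alpha : 'rV[R]_k) : \bar R :=
  ereal_inf [set ((inner alpha q)%:E + g q)%E | q in [set: 'rV[R]_k]].

Implicit Types (C : 'rV[R]_k -> R^o) (p : 'rV[R]_k).

Definition diff_quotient C p (j : 'I_k) (h : R) : R :=
  (C (p + h *: delta_mx 0 j) - C p) / h.

(* One-sided partial derivatives; the limits exist when C is convex. *)
Definition right_grad C p : 'rV[R]_k :=
  \row_j lim (diff_quotient C p j h @[h --> 0^'+]).
Definition left_grad C p : 'rV[R]_k :=
  \row_j lim (diff_quotient C p j h @[h --> 0^'-]).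

Definition grad C p : 'rV[R]_k := \row_j 'D_(delta_mx 0 j) C p.

End legendre_gradient.

(* Main.v *)
Require Import Defs.
From mathcomp Require Import all_boot all_order all_algebra.
From mathcomp Require Import all_classical all_reals all_analysis.
From mathcomp Require Import measurable_realfun lra ring.

Import Order.TTheory GRing.Theory Num.Theory.
Import numFieldNormedType.Exports.

Set Implicit Arguments.
Unset Strict Implicit.
Unset Printing Implicit Defensive.

Local Open Scope classical_set_scope.
Local Open Scope ring_scope.

(* A distance of uniform spaces bears the same name. *)
Local Notation edist := Defs.edist.

(** The measure [nu] is a Gibbs measure for the weight [mu(B(x,r))^q (2r)^t_q]:
    on the support, [log nu(B(x,r))] equals [<q, log mu(B(x,r))> + t_q log (2r)]
    up to [o(log r)] ([gibbs_scalingP]).  Everything follows from this and from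
    the law of large numbers hidden in the moments of [mu(B(x,r))] under [nu].

    The three exponents at [q].  For [t > t_q] the weights of exponent [t] of a
    packing of the support by small balls are at most the masses of its disjoint
    balls, of total mass at most 1, so that [Lambda(q) <= t_q]
    ([Lambda_le_gibbs]).  For [t < t_q] the weights of a covering are at least
    the masses of its balls, of total mass at least [nu(supp) = 1], so that
    [t_q <= b(q)] ([b_ge_gibbs]).  At every exponent vector [p] moreover
    [b(p) <= B(p) <= Lambda(p)]: a set with zero packing premeasure has zero
    covering premeasure, because it can be covered by balls of equal radii that
    split into a number of packings depending on the dimension only
    ([coloured_grid], [H_bar_P_bar_eq0]).  Hence the three exponents at [q] are
    all [t_q].

    Full measure of the level set.  The rate [C] is convex (Hoelder) and
    vanishes at 0, so the slopes [C(h e_j) / h] have one-sided limits at 0.  If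
    [C(p) < c], Markov's inequality bounds the [nu]-mass of the points with
    [mu(B(x,r_n))^p >= r_n^(-c)] by a power of [r_n], which is summable;
    by Borel-Cantelli almost every point leaves these sets ([moment_tail]).
    Taking for [p] small multiples of the basis vectors, of both signs, confines
    the local dimensions of [mu_j] along [r_n] between the one-sided partial
    derivatives of [C], and the condition [log r_(n+1) / log r_n --> 1] extends
    this to all radii ([grad_level_set_full]).

    Lower bound.  On the level set the Gibbs relation gives
    [nu(B(x,r)) <= r^s] for small [r] and every [s] below the announced bound:
    the sign of [q] selects which of the two one-sided gradients is used.  The
    mass distribution principle concludes ([hausdorff_dim_ge]).

    Upper bound.  On [X(alpha)], [mu(B(x,r))^p (2r)^t] is at least [(2r)^s] for
    [s > <alpha,p> + t], so that cheap coverings for the mixed measure of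
    exponents [p], [t] are cheap for the Hausdorff measure of exponent [s]:
    [dim X(alpha) <= <alpha,p> + b(p)] for all [p] ([mixed_spectrum_le]).
    When [C] is differentiable at 0 and [alpha] is the opposite of its
    gradient, the lower bound holds whatever the signs of the coordinates of
    [q], and squeezes the three Legendre transforms between [dim X(alpha)] and
    their value [<alpha,q> + t_q] at [q]. *)

(** * Euclidean balls and their measurability *)
Section euclidean_distance.
Context {R : realType} {n : nat}.
Implicit Types (x y z : 'rV[R]_n) (r s e : R).

Lemma edist_ge0 x y : 0 <= edist x y.
Proof. exact: sqrtr_ge0. Qed.

Lemma edistC x y : edist x y = edist y x.
Proof.
by rewrite /edist; congr Num.sqrt; apply: eq_bigr => i _; rewrite -sqrrN opprB.
Qed.

Lemma edistxx x : edist x x = 0.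
Proof. by rewrite /edist big1 ?sqrtr0// => i _; rewrite subrr expr0n. Qed.

Lemma coord_le_edist x y i : `|x 0 i - y 0 i| <= edist x y.
Proof.
rewrite -sqrtr_sqr ler_wsqrtr// (bigD1 i)//= lerDl.
by apply: sumr_ge0 => j _; exact: sqr_ge0.
Qed.

Lemma edist_le_coord x y s : 0 <= s ->
  (forall i, `|x 0 i - y 0 i| <= s) -> edist x y <= n%:R * s.
Proof.
move=> s0 xys; have ns0 : 0 <= n%:R * s by rewrite mulr_ge0.
rewrite -(ger0_norm ns0) -sqrtr_sqr ler_wsqrtr//.
apply: (@le_trans _ _ (\sum_(i < n) s ^+ 2)).
  by apply: ler_sum => i _; rewrite -real_normK ?num_real// lerXn2r// nnegrE.
rewrite sumr_const card_ord exprMn -[leLHS]mulr_natl ler_wpM2r ?sqr_ge0//.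
by rewrite -natrX ler_nat; case: (n) => // m; rewrite expnS leq_pmulr ?expn_gt0.
Qed.

(** Lagrange's identity: the defect is half the sum of the squares of the
    2 x 2 minors of the two families. *)
Lemma cauchy_schwarz_sum (a b : 'I_n -> R) :
  (\sum_i a i * b i) ^+ 2 <= (\sum_i a i ^+ 2) * (\sum_i b i ^+ 2).
Proof.
rewrite -subr_ge0.
suff <- : 2^-1 * \sum_i \sum_j (a i * b j - a j * b i) ^+ 2 =
    (\sum_i a i ^+ 2) * (\sum_i b i ^+ 2) - (\sum_i a i * b i) ^+ 2.
  by rewrite mulr_ge0// sumr_ge0// => i _; rewrite sumr_ge0// => j _;
    exact: sqr_ge0.
have E (f g : 'I_n -> R) : \sum_i \sum_j f i * g j = (\sum_i f i) * (\sum_j g j).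
  by rewrite mulr_suml; apply: eq_bigr => i _; rewrite mulr_sumr.
have -> : \sum_i \sum_j (a i * b j - a j * b i) ^+ 2 =
  \sum_i \sum_j a i ^+ 2 * b j ^+ 2 + \sum_i \sum_j b i ^+ 2 * a j ^+ 2
   - 2 * \sum_i \sum_j (a i * b i) * (a j * b j).
  rewrite mulr_sumr -sumrN -!big_split/=; apply: eq_bigr => i _.
  rewrite mulr_sumr -sumrN -!big_split/=; apply: eq_bigr => j _; ring.
by rewrite !E; field.
Qed.

Lemma edist_triangle y x z : edist x z <= edist x y + edist y z.
Proof.
have s0 : 0 <= edist x y + edist y z by rewrite addr_ge0// edist_ge0.
rewrite -(ger0_norm s0) -sqrtr_sqr ler_wsqrtr// sqrrD.
rewrite !sqr_sqrtr; try by apply: sumr_ge0 => i _; exact: sqr_ge0.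
have -> : \sum_i (x 0 i - z 0 i) ^+ 2 = \sum_i (x 0 i - y 0 i) ^+ 2 +
   (\sum_i (x 0 i - y 0 i) * (y 0 i - z 0 i)) *+ 2 +
   \sum_i (y 0 i - z 0 i) ^+ 2.
  rewrite -sumrMnl -!big_split/=; apply: eq_bigr => i _; ring.
rewrite lerD2r lerD2l lerMn2r; apply/orP; right.
rewrite -sqrtrM ?sumr_ge0//; last by move=> i _; exact: sqr_ge0.
apply: le_trans (ler_norm _) _.
by rewrite -sqrtr_sqr ler_wsqrtr// cauchy_schwarz_sum.
Qed.

Lemma eball_shift x y r s : edist x y + r <= s -> eball y r `<=` eball x s.
Proof.
move=> xyrs z; rewrite /eball/= => yzr.
by apply: le_trans (edist_triangle y _ _) _; apply: le_trans xyrs; rewrite lerD2l.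
Qed.

Lemma le_eball x r s : r <= s -> eball x r `<=` eball x s.
Proof. by move=> rs; apply: eball_shift; rewrite edistxx add0r. Qed.

(** Open sets are those of the product topology; comparing the Euclidean
    distance with the coordinates lets openness be checked on Euclidean balls. *)
Lemma open_edist (A : set 'rV[R]_n) :
  (forall x, A x -> exists2 e, 0 < e & forall y, edist x y < e -> A y) -> open A.
Proof.
move=> Ae; rewrite openE => x /Ae[e e0 eA].
have [n0|n0] := posnP n.
  apply: filterS (filterT) => y _; apply: eA.
  by rewrite /edist big1 ?sqrtr0// => i; exfalso; move: i; rewrite n0 => -[].
rewrite /interior; apply/nbhs_ballP; exists (e / (2 * n%:R)) => /=.
  by rewrite divr_gt0// mulr_gt0// ltr0n.
move=> y xy; apply: eA.
have n0' : 0 < n%:R :> R by rewrite ltr0n.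
apply: (@le_lt_trans _ _ (n%:R * (e / (2 * n%:R)))).
  apply: edist_le_coord; first by rewrite divr_ge0// ?ltW// mulr_gt0.
  by move=> i; apply/ltW; exact: (xy.2 0 i).
rewrite [ltLHS](_ : _ = e / 2) ?ltr_pdivrMr ?mulr2n//; first by lra.
by field; rewrite gt_eqF.
Qed.

Lemma measurable_open (A : set 'rV[R]_n) : open A ->
  measurable (A : set (borel_space R n)).
Proof. by move=> oA; apply: sub_sigma_algebra. Qed.

Lemma measurable_openC (A : set 'rV[R]_n) : open (~` A) ->
  measurable (A : set (borel_space R n)).
Proof. by move=> /measurable_open/measurableC; rewrite setCK. Qed.

Lemma measurable_eball x r : measurable (eball x r : set (borel_space R n)).
Proof.
apply: measurable_openC; apply: open_edist => y /= /negP; rewrite -ltNge => rxy.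
exists (edist x y - r); first by rewrite subr_gt0.
move=> z yz; rewrite /eball/=; apply/negP; rewrite -ltNge.
rewrite ltrBrDr -ltrBrDl in yz; apply: lt_le_trans yz _.
by rewrite lerBlDr (edistC y z) edist_triangle.
Qed.

End euclidean_distance.
#[global] Hint Extern 0 (measurable (eball _ _)) => exact: measurable_eball : core.

Section ball_mass_semicontinuity.
Context {R : realType} {d : nat}.
Implicit Types (x : 'rV[R]_d) (r : R).

(** Closed balls are the decreasing intersections of slightly larger ones, which
    makes the mass of a ball upper semicontinuous in its center. *)
Lemma ball_mass_usc (P : probability (borel_space R d) R) x r (c : \bar R) :
  (P (eball x r) < c)%E -> exists2 s, r < s & (P (eball x s) < c)%E.
Proof.
move=> Pc; pose F m : set (borel_space R d) := eball x (r + m.+1%:R^-1).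
have Fx : eball x r = \bigcap_m F m.
  apply/seteqP; split=> [y xy m _|y Fy].
    by apply: le_eball xy; rewrite lerDl.
  rewrite /eball/=; apply/ler_addgt0Pr => e e0.
  have [m me] := ltr_add_invr e0 (y := 0).
  rewrite add0r in me.
  by apply: le_trans (Fy m I) _; rewrite lerD2l ltW.
have cvgF : P (F m) @[m --> \oo] --> P (\bigcap_m F m).
  apply: nonincreasing_cvg_mu.
  - by rewrite (le_lt_trans (probability_le1 _ _)) ?ltry//; exact: measurable_eball.
  - by move=> m; exact: measurable_eball.
  - by rewrite -Fx; exact: measurable_eball.
  - move=> m1 m2 m12; apply/subsetPset; apply: le_eball.
    by rewrite lerD2l lef_pV2 ?posrE ?ltr0n// ler_nat ltnS.
rewrite -Fx in cvgF.
have : \forall m \near \oo, (P (F m) < c)%E.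
  by apply: (cvgF (fun u => (u < c)%E)); exact: open_ereal_lt'.
move=> [m _ /(_ m (leqnn m)) Pm].
by exists (r + m.+1%:R^-1); rewrite ?ltrDl.
Qed.

End ball_mass_semicontinuity.

(** * Logarithms of ball masses *)
Section inner_product.
Context {R : realType} {k : nat}.
Implicit Types (u v w : 'rV[R]_k) (a : R).

Lemma innerC u v : inner u v = inner v u.
Proof. by apply: eq_bigr => i _; rewrite mulrC. Qed.

Lemma innerDl u v w : inner (u + v) w = inner u w + inner v w.
Proof. by rewrite -big_split; apply: eq_bigr => i _; rewrite mxE mulrDl. Qed.

Lemma innerZl a u v : inner (a *: u) v = a * inner u v.
Proof. by rewrite mulr_sumr; apply: eq_bigr => i _; rewrite mxE mulrA. Qed.

Lemma innerNl u v : inner (- u) v = - inner u v.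
Proof. by rewrite -scaleN1r innerZl mulN1r. Qed.

Lemma inner0l u : inner 0 u = 0.
Proof. by rewrite -(scale0r 0) innerZl mul0r. Qed.

Lemma inner_delta j u : inner (delta_mx 0 j) u = u 0 j.
Proof.
rewrite /inner (bigD1 j)//= big1 ?addr0 ?mxE ?eqxx ?mul1r// => i ij.
by rewrite mxE (negPf ij) andbF mul0r.
Qed.

End inner_product.

Lemma probability_fine_le1 (R : realType) (d : measure_display) (T : measurableType d)
    (P : probability T R) (A : set T) : measurable A ->
  P A = (fine (P A))%:E /\ fine (P A) <= 1.
Proof.
move=> mA; have PA1 : (P A <= 1)%E by exact: probability_le1.
have PAfin : P A \is a fin_num.
  by rewrite ge0_fin_numE// (le_lt_trans PA1)// ltry.
by split; [rewrite fineK|rewrite -lee_fin fineK].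
Qed.

Section log_masses.
Context {R : realType} {d k : nat}.
Variable mu : 'I_k -> probability (borel_space R d) R.
Local Notation supp := (mixed_support mu).
Implicit Types (x : 'rV[R]_d) (p : 'rV[R]_k) (r s t : R).

(** The support is closed: a ball of measure zero around [x] contains a ball of
    half the radius around every point close to [x]. *)
Lemma measurable_mixed_support : measurable (supp : set (borel_space R d)).
Proof.
apply: measurable_openC; apply: open_edist => x /= /existsNP[r].
move=> /existsNP[j] /not_implyP[r0 /negP]; rewrite lt0e measure_ge0 andbT negbK.
move=> /eqP muj0; exists (r / 2); first by rewrite divr_gt0.
move=> y xy Sy; have := Sy (r / 2) j (divr_gt0 r0 (ltr0Sn R 1)).
suff -> : mu j (eball y (r / 2)) = 0%E by rewrite ltxx.
apply/eqP; rewrite -measure_le0 -muj0; apply: le_measure; rewrite ?inE//.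
by apply: eball_shift; rewrite [leRHS]splitr lerD2r ltW.
Qed.

Definition log_masses x r : 'rV[R]_k := \row_j ln (fine (mu j (eball x r))).

Lemma ball_massE x r j : mu j (eball x r) = (fine (mu j (eball x r)))%:E.
Proof. by have [] := probability_fine_le1 (mu j) (measurable_eball x r). Qed.

Lemma ball_mass_le1 x r j : fine (mu j (eball x r)) <= 1.
Proof. by have [] := probability_fine_le1 (mu j) (measurable_eball x r). Qed.

Lemma ball_mass_gt0 x r j : supp x -> 0 < r -> 0 < fine (mu j (eball x r)).
Proof. by move=> Sx r0; have := Sx r j r0; rewrite ball_massE lte_fin. Qed.

Lemma log_masses_le0 x r j : log_masses x r 0 j <= 0.
Proof. by rewrite mxE ln_le0// ball_mass_le1. Qed.

Lemma le_log_masses x r s j : supp x -> 0 < r -> r <= s ->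
  log_masses x r 0 j <= log_masses x s 0 j.
Proof.
move=> Sx r0 rs; rewrite !mxE ler_ln ?posrE ?ball_mass_gt0//; last first.
  exact: lt_le_trans rs.
rewrite -lee_fin -!ball_massE; apply: le_measure; rewrite ?inE//.
exact: le_eball.
Qed.

(** Masses are positive on the support, so that [mu(B(x,r))^p] is the
    exponential of a linear function of [p]; all estimates below are made on
    that function. *)
Lemma ball_powE p x r : supp x -> 0 < r ->
  ball_pow mu p x r = (expR (inner p (log_masses x r)))%:E.
Proof.
move=> Sx r0; rewrite /ball_pow /inner expR_sum.
rewrite (@big_morph _ _ EFin 1%E mule 1%R *%R)//.
apply: eq_bigr => j _; rewrite mxE /mass_pow gt_eqF ?Sx//=.
rewrite ball_massE poweR_EFin /powR gt_eqF//=.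
exact: ball_mass_gt0.
Qed.

Lemma measurable_ball_mass (P : probability (borel_space R d) R) r :
  measurable_fun [set: borel_space R d] (fun x : borel_space R d => P (eball x r)).
Proof.
apply: (measurability _ (ErealGenInftyO.measurableE R)).
move=> /= _ [_ [a ->]] <-; apply: measurableI => //.
rewrite preimage_itvNyo; apply: measurable_open; apply: open_edist => x /=.
move=> /ball_mass_usc[s rs Ps]; exists (s - r); first by rewrite subr_gt0.
move=> y xy; apply: le_lt_trans Ps; apply: le_measure; rewrite ?inE//.
by apply: eball_shift; rewrite -lerBrDr ltW.
Qed.

Lemma measurable_inner_log_masses p r :
  measurable_fun [set: borel_space R d] (fun x : borel_space R d => inner p (log_masses x r)).
Proof.
apply: measurable_sum => j; apply: measurable_funM => //.
under eq_fun do rewrite mxE.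
apply: measurableT_comp; first exact: measurable_ln.
apply: (measurableT_comp (fine_measurable measurableT)).
exact: measurable_ball_mass.
Qed.

End log_masses.

(** * One-sided limits and countable sums *)
Section monotone_limits.
Context {R : realType}.
Implicit Types (f : R -> \bar R).

Lemma lim_at_right_sup f : (forall r s, 0 < r -> r <= s -> (f s <= f r)%E) ->
  lim (f r @[r --> 0^'+]) = ereal_sup [set f r | r in [set r | 0 < r]].
Proof.
move=> fmono; apply/cvg_lim => //.
have -> : [set f r | r in [set r | 0 < r]] = f @` `]0, +oo[.
  by congr image; apply/seteqP; split=> r /=; rewrite in_itv/= andbT.
apply: (nonincreasing_at_right_cvge (BInfty _ false)) => // r s.
by rewrite !in_itv/= !andbT => r0 _ rs; exact: fmono.
Qed.

Lemma lim_at_right_inf f : (forall r s, 0 < r -> r <= s -> (f r <= f s)%E) ->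
  lim (f r @[r --> 0^'+]) = ereal_inf [set f r | r in [set r | 0 < r]].
Proof.
move=> fmono; apply/cvg_lim => //.
have -> : [set f r | r in [set r | 0 < r]] = f @` `]0, +oo[.
  by congr image; apply/seteqP; split=> r /=; rewrite in_itv/= andbT.
apply: (nondecreasing_at_right_cvge (BInfty _ false)) => // r s.
by rewrite !in_itv/= !andbT => r0 _ rs; exact: fmono.
Qed.

(** Radii small enough for a positive power to beat a given constant; this is
    what makes the measures jump from +oo to 0. *)
Lemma small_powR (M delta eta : R) : 0 <= M -> 0 < delta -> 0 < eta ->
  exists2 e0, 0 < e0 & forall e, 0 < e -> e <= e0 -> (2 * e) `^ delta * M <= eta.
Proof.
move=> M0 delta0 eta0; have M1 : 0 < M + 1 by rewrite ltr_wpDl.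
exists ((eta / (M + 1)) `^ delta^-1 / 2).
  by rewrite divr_gt0// powR_gt0// divr_gt0.
move=> e e0; rewrite ler_pdivlMr// mulrC => ee0.
have /(ge0_ler_powR (ltW delta0)) := ee0; rewrite !nnegrE powR_ge0.
rewrite mulr_ge0 ?(ltW e0)// => /(_ isT isT).
rewrite -powRrM mulVf ?gt_eqF// powRr1 ?divr_ge0 ?(ltW eta0) ?(ltW M1)// => h.
apply: (@le_trans _ _ (eta / (M + 1) * M)); first exact: ler_wpM2r.
by rewrite -mulrA ger_pMr// mulrC ler_pdivrMr// mul1r lerDl.
Qed.

End monotone_limits.

Section countable_sums.
Context {R : realType}.
Local Open Scope ereal_scope.

Lemma esumZl_le (T : choiceType) (I : set T) (a : T -> \bar R) (c : R) :
  (0 <= c)%R -> (forall i, I i -> 0 <= a i) ->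
  \esum_(i in I) (c%:E * a i) <= c%:E * \esum_(i in I) a i.
Proof.
move=> c0 a0; apply: ge_ereal_sup => _ [X [finX XI] <-].
rewrite fsbig_finite//= [X in X <= _](_ : _ = c%:E * \sum_(i \in X) a i).
  rewrite lee_wpmul2l ?lee_fin//; apply: ereal_sup_ubound.
  by exists X.
rewrite fsbig_finite//= big_seq [in RHS]big_seq ge0_sume_distrr// => i.
by rewrite in_fset_set// inE => /XI; exact: a0.
Qed.

Lemma esum_colour (C : finType) (I : set nat) (col : nat -> C)
    (a : nat -> \bar R) : (forall i, 0 <= a i) ->
  \esum_(i in I) a i = \sum_(c : C) \esum_(i in I `&` [set i | col i = c]) a i.
Proof.
move=> a0.
transitivity (\esum_(i in I) \sum_(c : C) (if col i == c then a i else 0)).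
  apply: eq_esum => i _; rewrite (bigD1 (col i))//= eqxx big1 ?adde0// => c.
  by rewrite eq_sym => /negPf ->.
rewrite esum_sum; last by move=> i c _ _; case: ifP.
apply: eq_bigr => c _; rewrite esum_mkcondr; apply: eq_esum => i _.
by congr (if _ then _ else _); apply/eqP/idP => [|]; rewrite inE.
Qed.

(** Countably many countable families whose sums are dominated by a geometric
    series are merged into a single family indexed by [nat]; this gives the
    countable stability of null sets for all measures defined by coverings. *)
Lemma merge_families (T : Type) (w : T -> \bar R) (fam : nat -> set nat)
    (y : nat -> nat -> T) (eta : R) :
  (forall z, 0 <= w z) -> (0 <= eta)%R ->
  (forall n, \esum_(i in fam n) w (y n i) <= (eta / (2 ^ n.+1)%:R)%:E) ->
  exists (I : set nat) (z : nat -> T), [/\ \esum_(m in I) w (z m) <= eta%:E,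
    forall m, I m -> exists n i, fam n i /\ z m = y n i &
    forall n i, fam n i -> exists2 m, I m & z m = y n i].
Proof.
move=> w0 eta0 famy; have := card_nat2; rewrite card_eq_sym => /card_set_bijP.
move=> [f [_ finj fsurj]].
exists [set m | fam (f m).1 (f m).2], (fun m => y (f m).1 (f m).2).
have fbij : set_bij [set m | fam (f m).1 (f m).2] (setT `*`` fam) f.
  split.
  - by move=> m /= fm.
  - by move=> m1 m2 _ _; apply: finj; rewrite inE.
  - by move=> [n i] /= [_ ni]; have [m _ fm] := fsurj (n, i) I; exists m;
      rewrite /= ?fm.
split.
- have /= <- := reindex_esum _ _ f (fun p : nat * nat => w (y p.1 p.2)) fbij.
  rewrite -(esum_esum (a := fun n i => w (y n i)))//.
  apply: le_trans (epsilon_trick0 xpredT eta0).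
  by rewrite nneseries_esumT => [|n]; [exact: le_esum|rewrite lee_fin divr_ge0].
- by move=> m fm; exists (f m).1, (f m).2.
- by move=> n i ni; have [m _ fm] := fsurj (n, i) I; exists m; rewrite /= fm.
Qed.

Section measure_sums.
Context {dd : measure_display} {T : measurableType dd}.
Variable P : probability T R.
Implicit Types (I : set nat) (F : nat -> set T).

Lemma measure_cover_le I F A : measurable A -> (forall i, measurable (F i)) ->
  A `<=` \bigcup_(i in I) F i -> P A <= \esum_(i in I) P (F i).
Proof.
move=> mA mF AF; have -> : \esum_(i in I) P (F i) =
    \sum_(i <oo) P (if i \in I then F i else set0).
  rewrite nneseries_esumT// [LHS]esum_mkcond; apply: eq_esum => i _.
  by case: ifP; rewrite ?measure0.
apply: measure_sigma_subadditive => //; first by move=> n; case: ifP.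
by rewrite -bigcup_mkcond.
Qed.

Lemma measure_packing_le I F : (forall i, measurable (F i)) -> trivIset I F ->
  \esum_(i in I) P (F i) <= 1.
Proof.
move=> mF tF; have -> : \esum_(i in I) P (F i) = P (\bigcup_(i in I) F i).
  by rewrite measure_bigcup// nneseries_esum// set_mem_set.
by apply: probability_le1; exact: bigcup_measurable.
Qed.

End measure_sums.

End countable_sums.

(** * Coloured coverings by balls of equal radii *)
Section coloured_grid.
Context {R : realType}.

Lemma floor_eq_lt1 (a b : R) : Num.floor a = Num.floor b -> `|a - b| < 1.
Proof.
move=> ab; have := floor_itv a; have := floor_itv b; rewrite ab !intrD.
by move=> /andP[b1 b2] /andP[a1 a2]; rewrite ltr_norml; apply/andP; split; lra.
Qed.

(** Two distinct integers that are congruent modulo m + 1 are at distance at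
    least m + 1, and each point lies within 1 of its integer part. *)
Lemma floor_modz_gt (a b : R) (m : nat) : Num.floor a <> Num.floor b ->
  (Num.floor a = Num.floor b %[mod m.+1])%Z -> m%:R < `|a - b|.
Proof.
move=> ab /eqP; rewrite eqz_mod_dvd => /dvdzP[z zab].
have z1 : 1 <= `|z|.
  rewrite -gtz0_ge1 normr_gt0; apply/eqP => z0; apply: ab.
  by apply/eqP; rewrite -subr_eq0 zab z0 mul0r.
have zm : m.+1%:R <= `|(Num.floor a - Num.floor b)%:~R| :> R.
  rewrite zab -intr_norm normrM intrM [X in _ <= _ * X](_ : _ = m.+1%:R)//.
  by rewrite ler_peMl// (_ : 1 = 1%:~R)// ler_int.
have := floor_itv a; have := floor_itv b; rewrite !intrD.
move=> /andP[b1 b2] /andP[a1 a2].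
have {zm} : m.+1%:R <= `|(Num.floor a)%:~R - (Num.floor b)%:~R| :> R.
  by rewrite -intrB.
rewrite -natr1 ler_normr ltr_normr.
by case/orP => h; apply/orP; [left|right]; lra.
Qed.

(** The cells are cubes of side r / d, whose Euclidean diameter is at most r:
    one point of [F] per occupied cell already yields a covering.  Giving a
    cell the colour of its coordinates modulo 2 d + 1 keeps two cells of the
    same colour further than 2 r apart.  Since the number of colours does not
    depend on [F] nor on [r], this replaces the covering theorem of Besicovitch
    for families of balls of equal radii. *)
Lemma coloured_grid (d : nat) : (0 < d)%N ->
  exists C : finType, forall (F : set 'rV[R]_d) (r : R), 0 < r ->
  exists (I : set nat) (x : nat -> 'rV[R]_d) (col : nat -> C),
  [/\ forall i, I i -> F (x i), F `<=` \bigcup_(i in I) eball (x i) r &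
      forall c, trivIset (I `&` [set i | col i = c]) (fun i => eball (x i) r)].
Proof.
move=> d0; exists {ffun 'I_d -> 'I_(2 * d).+1} => F r r0.
have dr0 : 0 < d%:R / r by rewrite divr_gt0// ltr0n.
pose cell (y : 'rV[R]_d) := [ffun i : 'I_d => Num.floor (y 0 i * (d%:R / r))].
pose I := [set i | exists2 y, F y & pickle (cell y) = i].
pose x i := xget 0 [set y | F y /\ pickle (cell y) = i].
pose col i : {ffun 'I_d -> 'I_(2 * d).+1} :=
  [ffun l => inord `|(cell (x i) l %% (2 * d).+1)%Z|].
have xP i : I i -> F (x i) /\ pickle (cell (x i)) = i.
  move=> [y Fy yi].
  exact: (@xgetPex _ 0 [set y | F y /\ pickle (cell y) = i]
    (ex_intro _ y (conj Fy yi))).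
exists I, x, col; split.
- by move=> i /xP[].
- move=> y Fy; pose i := pickle (cell y).
  have Ii : I i by exists y.
  exists i => //; have [_ /(pcan_inj pickleK) /ffunP xy] := xP _ Ii.
  rewrite /eball/=; have -> : r = d%:R * (r / d%:R).
    by field; rewrite pnatr_eq0 -lt0n.
  apply: edist_le_coord; first by rewrite divr_ge0// ltW.
  move=> l; have := xy l; rewrite !ffunE => /floor_eq_lt1.
  rewrite -mulrBl normrM (gtr0_norm dr0) -ltr_pdivlMr// mul1r invf_div.
  exact: ltW.
- move=> c i j [Ii ci] [Ij cj] [z [/= xiz xjz]].
  have [/xP[_ xi] /xP[_ xj]] := (Ii, Ij).
  rewrite -xi -xj; congr pickle; apply/ffunP => l.
  apply: contrapT => cij.
  have mij : (cell (x i) l = cell (x j) l %[mod (2 * d).+1])%Z.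
    have : nat_of_ord (col i l) = col j l by rewrite ci cj.
    have Hlt (m : int) : (`|(m %% (2 * d).+1)%Z| < (2 * d).+1)%N.
      by rewrite -ltz_nat gez0_abs ?modz_ge0// ltz_pmod.
    rewrite /col ffunE [X in _ = nat_of_ord X]ffunE !inordK ?Hlt//.
    move=> /(congr1 Posz).
    by rewrite !gez0_abs ?modz_ge0.
  move: cij mij; rewrite !ffunE => cij mij.
  have := floor_modz_gt cij mij.
  rewrite -mulrBl normrM (gtr0_norm dr0).
  rewrite -ltr_pdivrMr// natrM invf_div.
  have -> : 2 * d%:R * (r / d%:R) = 2 * r.
    by field; rewrite pnatr_eq0 -lt0n.
  apply/negP; rewrite -leNgt.
  have -> : x i 0 l - x j 0 l = (x i 0 l - z 0 l) + - (x j 0 l - z 0 l) by ring.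
  apply: le_trans (ler_normD _ _) _; rewrite normrN mulr2n mulrDl mul1r.
  by apply: lerD; apply: le_trans (coord_le_edist _ _ _) _.
Qed.

End coloured_grid.

(** * Mixed multifractal measures *)
Section multifractal_measures.
Context {R : realType} {d k : nat}.
Variable mu : 'I_k -> probability (borel_space R d) R.
Implicit Types (E F : set 'rV[R]_d) (q : 'rV[R]_k) (t eps : R).
Local Open Scope ereal_scope.

Lemma ball_pow_ge0 q x r : 0 <= ball_pow mu q x r.
Proof.
apply: prode_ge0 => j _; rewrite /mass_pow; case: ifP => // _; exact: poweR_ge0.
Qed.

Lemma ball_term_ge0 q t x r : 0 <= ball_pow mu q x r * ((2 * r) `^ t)%:E.
Proof. by rewrite mule_ge0 ?ball_pow_ge0// lee_fin powR_ge0. Qed.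

Lemma ball_sum_ge0 q t I x r : 0 <= ball_sum mu q t I x r.
Proof. by apply: esum_ge0 => i _; exact: ball_term_ge0. Qed.

(** Raising the exponent multiplies a sum over balls of radii less than [eps] by
    a factor that vanishes with [eps]; hence each of the measures built on such
    sums jumps from +oo to 0 as the exponent grows. *)
Lemma ball_sum_exponent q t t' (I : set nat) (x : nat -> 'rV[R]_d)
    (r : nat -> R) eps : (forall i, I i -> (0 < r i < eps)%R) -> (t <= t')%R ->
  ball_sum mu q t' I x r <= ((2 * eps) `^ (t' - t))%:E * ball_sum mu q t I x r.
Proof.
move=> reps tt'; apply: le_trans; last first.
  by apply: esumZl_le; [exact: powR_ge0|move=> i _; exact: ball_term_ge0].
apply: le_esum => i /reps/andP[r0 re]; rewrite muleCA lee_wpmul2l ?ball_pow_ge0//.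
rewrite -EFinM lee_fin -[X in (_ `^ X <= _)%R](subrK t) (@powRD _ (2 * r i)); last first.
  by apply/implyP => _; rewrite gt_eqF// mulr_gt0.
rewrite ler_wpM2r ?powR_ge0// ge0_ler_powR ?nnegrE ?subr_ge0//.
- by rewrite mulr_ge0// ltW.
- by rewrite mulr_ge0// ltW// (lt_trans r0).
- by rewrite ler_pM2l// ltW.
Qed.

Lemma H_eps_ge0 q t eps E : 0 <= H_eps mu q t eps E.
Proof.
by apply: le_ereal_inf_tmp => _ [I [x [r [_ ->]]]]; exact: ball_sum_ge0.
Qed.

Lemma P_eps_ge0 q t eps E : 0 <= P_eps mu q t eps E.
Proof.
apply: ereal_sup_ubound; exists set0, (fun=> 0%R), (fun=> 0%R).
split; last by rewrite /ball_sum esum_set0.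
by split => // i j [].
Qed.

Lemma le_H_eps q t eps1 eps2 E : (eps1 <= eps2)%R ->
  H_eps mu q t eps2 E <= H_eps mu q t eps1 E.
Proof.
move=> e12; apply: ereal_inf_le_tmp => z [I [x [r [[xr cov] ->]]]].
exists I, x, r; split => //; split=> // i /xr[Ex /andP[r0 re]]; split=> //.
by rewrite r0 (lt_le_trans re).
Qed.

Lemma le_P_eps q t eps1 eps2 E : (eps1 <= eps2)%R ->
  P_eps mu q t eps1 E <= P_eps mu q t eps2 E.
Proof.
move=> e12; apply: le_ereal_sup => z [I [x [r [[xr pack] ->]]]].
exists I, x, r; split => //; split=> // i /xr[Ex /andP[r0 re]]; split=> //.
by rewrite r0 (lt_le_trans re).
Qed.

Lemma P_eps_subset q t eps E F : E `<=` F ->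
  P_eps mu q t eps E <= P_eps mu q t eps F.
Proof.
move=> EF; apply: le_ereal_sup => z [I [x [r [[xr pack] ->]]]].
by exists I, x, r; split => //; split=> // i /xr[/EF].
Qed.

Lemma H_barE q t E : H_bar mu q t E =
  ereal_sup [set H_eps mu q t eps E | eps in [set eps | (0 < eps)%R]].
Proof. by apply: lim_at_right_sup => r s _; exact: le_H_eps. Qed.

Lemma P_barE q t E : P_bar mu q t E =
  ereal_inf [set P_eps mu q t eps E | eps in [set eps | (0 < eps)%R]].
Proof. by apply: lim_at_right_inf => r s _; exact: le_P_eps. Qed.

Lemma H_eps_le_bar q t E eps : (0 < eps)%R -> H_eps mu q t eps E <= H_bar mu q t E.
Proof. by move=> e0; rewrite H_barE; apply: ereal_sup_ubound; exists eps. Qed.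

Lemma H_bar_ge0 q t E : 0 <= H_bar mu q t E.
Proof. exact: le_trans (H_eps_ge0 q t 1 E) (H_eps_le_bar _ _ _ _). Qed.

Lemma P_bar_ge0 q t E : 0 <= P_bar mu q t E.
Proof.
by rewrite P_barE; apply: le_ereal_inf_tmp => _ [eps _ <-]; exact: P_eps_ge0.
Qed.

Lemma P_bar_subset q t E F : E `<=` F -> P_bar mu q t E <= P_bar mu q t F.
Proof.
move=> EF; rewrite !P_barE; apply: le_ereal_inf_tmp => _ [eps e0 <-].
apply: ge_ereal_inf; exists (P_eps mu q t eps E); first by exists eps.
exact: P_eps_subset.
Qed.

Lemma H_bar_eq0P q t E : H_bar mu q t E = 0 <->
  forall eps eta, (0 < eps)%R -> (0 < eta)%R -> exists I x r,
    centered_covering eps E I x r /\ ball_sum mu q t I x r <= eta%:E.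
Proof.
split=> [H0 eps eta eps0 eta0|small].
  have : H_eps mu q t eps E < eta%:E.
    by apply: le_lt_trans (H_eps_le_bar _ _ _ eps0) _; rewrite H0 lte_fin.
  by move=> /ereal_inf_lt[_ [I [x [r [cov ->]]]] /ltW]; exists I, x, r.
apply/eqP; rewrite eq_le H_bar_ge0 andbT H_barE.
apply: ge_ereal_sup => _ [eps eps0 <-]; apply/lee_addgt0Pr => eta eta0.
rewrite add0e; have [I [x [r [cov le]]]] := small _ _ eps0 eta0.
by apply: ge_ereal_inf; exists (ball_sum mu q t I x r) => //; exists I, x, r.
Qed.

Lemma H_bar_jump q t t' E : H_bar mu q t E < +oo -> (t < t')%R ->
  H_bar mu q t' E = 0.
Proof.
move=> Hoo tt'; apply/H_bar_eq0P => eps eta eps0 eta0.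
have [M M0 HM] : exists2 M, (0 <= M)%R & H_bar mu q t E < M%:E.
  exists (fine (H_bar mu q t E) + 1)%R.
    by rewrite addr_ge0// fine_ge0// H_bar_ge0.
  rewrite EFinD fineK ?ge0_fin_numE ?H_bar_ge0// lteDl// ge0_fin_numE//.
  exact: H_bar_ge0.
have dt : (0 < t' - t)%R by rewrite subr_gt0.
have [e0 e00 small] := small_powR M0 dt eta0.
have e10 : (0 < Num.min e0 eps)%R by rewrite lt_min e00.
have [_ [I [x [r [[xr cov] ->]]]] /ltW sumM] :=
  ereal_inf_lt (le_lt_trans (H_eps_le_bar q t E e10) HM).
exists I, x, r; split.
  split=> // i /xr[Ex /andP[ri0 rie]]; split=> //.
  by rewrite ri0 (lt_le_trans rie)// ge_min lexx orbT.
apply: le_trans (ball_sum_exponent q x (fun i Ii => (xr i Ii).2) (ltW tt')) _.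
apply: le_trans (lee_wpmul2l _ sumM) _; first by rewrite lee_fin powR_ge0.
by rewrite -EFinM lee_fin small// ge_min lexx.
Qed.

Lemma P_bar_jump q t t' E : P_bar mu q t E < +oo -> (t < t')%R ->
  P_bar mu q t' E = 0.
Proof.
rewrite {1}P_barE => /ereal_inf_lt[_ [e1 /= e10 <-] Poo] tt'.
have Pfin : P_eps mu q t e1 E = (fine (P_eps mu q t e1 E))%:E.
  by rewrite fineK// ge0_fin_numE// P_eps_ge0.
apply/eqP; rewrite eq_le P_bar_ge0 andbT; apply/lee_addgt0Pr => eta eta0.
have M0 : (0 <= fine (P_eps mu q t e1 E))%R by rewrite fine_ge0// P_eps_ge0.
have dt : (0 < t' - t)%R by rewrite subr_gt0.
have [e0 e00 small] := small_powR M0 dt eta0.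
have e20 : (0 < Num.min e0 e1)%R by rewrite lt_min e00.
rewrite add0e P_barE; apply: ge_ereal_inf.
exists (P_eps mu q t' (Num.min e0 e1) E); first by exists (Num.min e0 e1).
apply: ge_ereal_sup => _ [I [x [r [[xr pack] ->]]]].
apply: le_trans (ball_sum_exponent q x (fun i Ii => (xr i Ii).2) (ltW tt')) _.
apply: (@le_trans _ _ (((2 * Num.min e0 e1) `^ (t' - t))%:E *
    P_eps mu q t e1 E)).
  rewrite lee_wpmul2l ?lee_fin ?powR_ge0//; apply: ereal_sup_ubound.
  exists I, x, r; split=> //; split=> // i /xr[Ex /andP[r0 re]]; split=> //.
  by rewrite r0 (lt_le_trans re)// ge_min lexx orbT.
by rewrite Pfin -EFinM lee_fin small// ge_min lexx.
Qed.

Lemma H_mes_jump q t t' E : H_mes mu q t E < +oo -> (t < t')%R ->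
  H_mes mu q t' E = 0.
Proof.
move=> Hoo tt'; rewrite /H_mes (_ : [set _ | _ in _] = [set 0]) ?ereal_sup1//.
apply/seteqP; split=> [_ [F FE <-]/=|_ -> /=].
  apply: H_bar_jump tt'; apply: le_lt_trans Hoo; apply: ereal_sup_ubound.
  by exists F.
exists E => //; apply: H_bar_jump tt'; apply: le_lt_trans Hoo.
by apply: ereal_sup_ubound; exists E.
Qed.

Lemma P_mes_ge0 q t E : 0 <= P_mes mu q t E.
Proof.
apply: le_ereal_inf_tmp => _ [F [_ ->]]; apply: nneseries_ge0 => n _ _.
exact: P_bar_ge0.
Qed.

Lemma P_mes_lty q t E : P_mes mu q t E < +oo ->
  exists2 F : nat -> set 'rV[R]_d, E `<=` \bigcup_i F i &
    forall i, P_bar mu q t (F i) < +oo.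
Proof.
move=> /ereal_inf_lt[_ [F [EF ->]] Foo]; exists F => // i.
apply: le_lt_trans Foo; rewrite nneseries_esumT; last by move=> ?; exact: P_bar_ge0.
apply: esum_ge; exists [set i]; first by split.
by rewrite fsbig_set1.
Qed.

Lemma P_mes_eq0 q t E (F : nat -> set 'rV[R]_d) : E `<=` \bigcup_i F i ->
  (forall i, P_bar mu q t (F i) = 0) -> P_mes mu q t E = 0.
Proof.
move=> EF F0; apply/eqP; rewrite eq_le P_mes_ge0 andbT; apply: ge_ereal_inf.
exists (\sum_(0 <= i <oo) P_bar mu q t (F i)); first by exists F.
by rewrite eseries0.
Qed.

Lemma P_mes_jump q t t' E : P_mes mu q t E < +oo -> (t < t')%R ->
  P_mes mu q t' E = 0.
Proof.
move=> /P_mes_lty[F EF Foo] tt'; apply: (P_mes_eq0 EF) => i.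
exact: P_bar_jump (Foo i) tt'.
Qed.

(** Split a coloured covering of radius eps / 2 into its colours: each of them
    is a centered packing. *)
Lemma H_bar_P_bar_eq0 q t E : (0 < d)%N -> P_bar mu q t E = 0 ->
  H_bar mu q t E = 0.
Proof.
move=> d0 P0; have [C grid] := @coloured_grid R d d0.
apply/H_bar_eq0P => eps eta eps0 eta0.
pose eta' := (eta / (#|C|%:R + 1))%R.
(* Each colour class contributes at most eta / (#|C| + 1); the added 1 only
   prevents a division by zero. *)
have c0 : (0 < #|C|%:R + 1 :> R)%R by rewrite ltr_wpDl.
have : P_bar mu q t E < eta'%:E by rewrite P0 lte_fin divr_gt0.
rewrite P_barE => /ereal_inf_lt[_ [e1 /= e10 <-] /ltW Peta].
pose r := (Num.min eps e1 / 2)%R.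
have e20 : (0 < Num.min eps e1)%R by rewrite lt_min eps0.
have r0 : (0 < r)%R by rewrite divr_gt0.
have re : (r < Num.min eps e1)%R by rewrite ltr_pdivrMr// mulr2n mulrDr mulr1 ltrDl.
have [I [x [col [Ex cov pack]]]] := grid E r r0.
exists I, x, (fun=> r); split.
  split=> // i /Ex Exi; split=> //; rewrite r0 (lt_le_trans re)//.
  by rewrite ge_min lexx.
rewrite /ball_sum (esum_colour _ col) => [|i]; last exact: ball_term_ge0.
apply: (@le_trans _ _ (\sum_(c : C) eta'%:E)).
  apply: lee_sum => c _; apply: le_trans Peta; apply: ereal_sup_ubound.
  exists (I `&` [set i | col i = c]), x, (fun=> r); split=> //; split=> //.
  move=> i [/Ex Exi _]; split=> //; rewrite r0 (lt_le_trans re)//.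
  by rewrite ge_min lexx orbT.
rewrite sumEFin lee_fin sumr_const -[leLHS]mulr_natr /eta' mulrAC.
by rewrite ler_pdivrMr// ler_wpM2l ?(ltW eta0)// lerDl.
Qed.

Lemma H_bar_bigcup_eq0 q t (F : nat -> set 'rV[R]_d) :
  (forall n, H_bar mu q t (F n) = 0) -> H_bar mu q t (\bigcup_n F n) = 0.
Proof.
move=> F0; apply/H_bar_eq0P => eps eta eps0 eta0.
have : forall n, exists I_z : set nat * (nat -> 'rV[R]_d * R),
    centered_covering eps (F n) I_z.1 (fst \o I_z.2) (snd \o I_z.2) /\
    ball_sum mu q t I_z.1 (fst \o I_z.2) (snd \o I_z.2) <=
      (eta / (2 ^ n.+1)%:R)%:E.
  move=> n; have /H_bar_eq0P/(_ eps (eta / (2 ^ n.+1)%:R)%R eps0) := F0 n.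
  move=> [|I [x [r cov]]]; first by rewrite divr_gt0// ltr0n expn_gt0.
  by exists (I, fun i => (x i, r i)).
move=> /choice[f fP].
pose w (z : 'rV[R]_d * R) := ball_pow mu q z.1 z.2 * ((2 * z.2) `^ t)%:E.
have [||I [z [sumz zP Iz]]] := @merge_families _ _ w (fun n => (f n).1)
  (fun n => (f n).2) eta _ (ltW eta0).
- by move=> z; exact: ball_term_ge0.
- by move=> n; have [] := fP n.
exists I, (fst \o z), (snd \o z); split=> //; split.
  move=> m /zP[n [i [fi zm]]] /=; rewrite zm.
  by have [[/(_ i fi)[Fx rx] _] _] := fP n; split=> //; exists n.
move=> y [n _ Fy]; have [[_ /(_ y Fy)[i fi yi]] _] := fP n.
by have [m Im zm] := Iz n i fi; exists m => //=; rewrite zm.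
Qed.

Lemma H_mes_eq0 q t E : (forall F, F `<=` E -> H_bar mu q t F = 0) ->
  H_mes mu q t E = 0.
Proof.
move=> H0; rewrite /H_mes (_ : [set _ | _ in _] = [set 0]) ?ereal_sup1//.
apply/seteqP; split=> [_ [F FE <-]/=|_ -> /=]; first exact: H0.
by exists E => //; exact: H0.
Qed.

Lemma H_bar_le_mes q t E F : F `<=` E -> H_bar mu q t F <= H_mes mu q t E.
Proof. by move=> FE; apply: ereal_sup_ubound; exists F. Qed.

(** Each piece of a countable cover with finite packing premeasures becomes
    null for the packing premeasure, hence for the covering premeasure, as soon
    as the exponent increases. *)
Lemma H_mes_P_mes_eq0 q t t' E : (0 < d)%N -> P_mes mu q t E < +oo ->
  (t < t')%R -> H_mes mu q t' E = 0.
Proof.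
move=> d0 /P_mes_lty[F EF Foo] tt'; apply: H_mes_eq0 => G GE.
have -> : G = \bigcup_n (G `&` F n).
  by rewrite -setI_bigcupr; apply/esym/setIidl; exact: subset_trans EF.
apply: H_bar_bigcup_eq0 => n; apply: H_bar_P_bar_eq0 => //.
apply/eqP; rewrite eq_le P_bar_ge0 andbT -(P_bar_jump (Foo n) tt').
exact: P_bar_subset.
Qed.

End multifractal_measures.

(** * Critical exponents, and their value at q *)
Section critical_exponents.
Context {R : realType}.
Implicit Types (g h : R -> \bar R) (c : \bar R) (t : R).
Local Open Scope ereal_scope.

Lemma ereal_between (a b : \bar R) : a < b -> exists2 t, a < t%:E & t%:E < b.
Proof.
case: a b => [a| |] [b| |]//= ab.
- by exists ((a + b) / 2)%R; rewrite !lte_fin in ab *; lra.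
- by exists (a + 1)%R; rewrite ?ltry// lte_fin; lra.
- by exists (b - 1)%R; rewrite ?ltNyr// lte_fin; lra.
- by exists 0%R; rewrite ?ltry ?ltNyr.
Qed.

(** The cutoff is the infimum of the exponents at which [g] is finite. *)
Lemma cutoffP g : (forall t t', g t < +oo -> (t < t')%R -> g t' = 0) ->
  is_cutoff g (cutoff g).
Proof.
move=> jump; apply: xgetPex.
exists (ereal_inf [set t%:E | t in [set t | g t < +oo]]) => t; split.
  move=> tlt; apply: contrapT => /eqP; rewrite -ltey => gt.
  move: tlt; apply/negP; rewrite -leNgt; apply: ereal_inf_lbound.
  by exists t.
move=> /ereal_inf_lt[_ [t0 /= gt0 <-]]; rewrite lte_fin; exact: jump.
Qed.

Lemma cutoff_le g h c c' : is_cutoff g c -> is_cutoff h c' ->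
  (forall t t', h t = 0 -> (t < t')%R -> g t' = 0) -> c <= c'.
Proof.
move=> gc hc' hg; rewrite leNgt; apply/negP => /ereal_between[t' c't' t'c].
have [t c't tt'] := ereal_between c't'.
have := hg t t' ((hc' t).2 c't); rewrite -lte_fin => /(_ tt').
by rewrite (gc t').1.
Qed.

Context {d k : nat}.
Variable mu : 'I_k -> probability (borel_space R d) R.
Implicit Types (q : 'rV[R]_k).

Lemma b_dimP q : is_cutoff (fun t => H_mes mu q t (mixed_support mu)) (b_dim mu q).
Proof. by apply: cutoffP => t t'; exact: H_mes_jump. Qed.

Lemma B_dimP q : is_cutoff (fun t => P_mes mu q t (mixed_support mu)) (B_dim mu q).
Proof. by apply: cutoffP => t t'; exact: P_mes_jump. Qed.

Lemma Lambda_dimP q :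
  is_cutoff (fun t => P_bar mu q t (mixed_support mu)) (Lambda_dim mu q).
Proof. by apply: cutoffP => t t'; exact: P_bar_jump. Qed.

Lemma b_le_B q : (0 < d)%N -> b_dim mu q <= B_dim mu q.
Proof.
move=> d0; apply: (cutoff_le (b_dimP q) (B_dimP q)) => t t' P0.
by apply: H_mes_P_mes_eq0 => //; rewrite P0.
Qed.

Lemma B_le_Lambda q : B_dim mu q <= Lambda_dim mu q.
Proof.
apply: (cutoff_le (B_dimP q) (Lambda_dimP q)) => t t' P0 tt'.
apply: (@P_mes_eq0 _ _ _ mu q t' _ (fun=> mixed_support mu)) => [x Sx|_].
  by exists 0%N.
by apply: P_bar_jump tt'; rewrite P0.
Qed.

End critical_exponents.

Section auxiliary_measure.
Context {R : realType} {d k : nat}.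
Variable mu : 'I_k -> probability (borel_space R d) R.
Local Notation supp := (mixed_support mu).
Variable nu : probability (borel_space R d) R.
Implicit Types (x : 'rV[R]_d) (q : 'rV[R]_k) (r s t : R).

(** The ratio of [nu(B(x,r))] to [mu(B(x,r))^q (2r)^t] is [r^o(1)], uniformly on
    the support.  The condition [2 * r < 1] fixes the sign of [ln (2 * r)]. *)
Definition gibbs_scaling q t := forall eps, 0 < eps ->
  exists2 rho, 0 < rho & forall x r, supp x -> 0 < r < rho ->
    [/\ 2 * r < 1, 0 < fine (nu (eball x r)) &
    `|ln (fine (nu (eball x r))) - (inner q (log_masses mu x r) + t * ln (2 * r))|
      <= - (eps * ln (2 * r))].

Lemma ball_term_expR q t x r : supp x -> 0 < r ->
  (ball_pow mu q x r * ((2 * r) `^ t)%:E)%E =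
  (expR (inner q (log_masses mu x r) + t * ln (2 * r)))%:E.
Proof.
move=> Sx r0; rewrite ball_powE// -EFinM expRD; congr (_ * _)%:E.
by rewrite /powR gt_eqF// mulr_gt0.
Qed.

Lemma ball_nuE x r : nu (eball x r) = (fine (nu (eball x r)))%:E.
Proof. by have [] := probability_fine_le1 nu (measurable_eball x r). Qed.

Lemma gibbs_term_le q t s : gibbs_scaling q t -> t < s ->
  exists2 rho, 0 < rho & forall x r, supp x -> 0 < r < rho ->
    (ball_pow mu q x r * ((2 * r) `^ s)%:E <= nu (eball x r))%E.
Proof.
move=> gibbs ts; have := gibbs (s - t); rewrite subr_gt0 => /(_ ts)[rho rho0 H].
exists rho => // x r Sx rrho; have [r2 nu0] := H x r Sx rrho.
have /andP[r0 _] := rrho.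
rewrite ler_norml => /andP[+ _]; rewrite ball_term_expR// ball_nuE lee_fin.
move=> h; rewrite -[leRHS]lnK ?posrE// ler_expR; lra.
Qed.

Lemma gibbs_term_ge q t s : gibbs_scaling q t -> s < t ->
  exists2 rho, 0 < rho & forall x r, supp x -> 0 < r < rho ->
    (nu (eball x r) <= ball_pow mu q x r * ((2 * r) `^ s)%:E)%E.
Proof.
move=> gibbs st; have := gibbs (t - s); rewrite subr_gt0 => /(_ st)[rho rho0 H].
exists rho => // x r Sx rrho; have [r2 nu0] := H x r Sx rrho.
have /andP[r0 _] := rrho.
rewrite ler_norml => /andP[_ +]; rewrite ball_term_expR// ball_nuE lee_fin.
move=> h; rewrite -[leLHS]lnK ?posrE// ler_expR; lra.
Qed.

(** The balls of a packing are disjoint, so their [nu]-masses add up to at most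
    1; above [t] these masses dominate the weights. *)
Lemma Lambda_le_gibbs q t : gibbs_scaling q t -> (Lambda_dim mu q <= t%:E)%E.
Proof.
move=> gibbs; rewrite leNgt; apply/negP => /ereal_between[s].
rewrite lte_fin => ts /(Lambda_dimP mu q s).1 /eqP; apply/negP.
have [rho rho0 term] := gibbs_term_le gibbs ts.
rewrite -ltey (@le_lt_trans _ _ 1%E)// ?ltry// P_barE; apply: ge_ereal_inf.
exists (P_eps mu q s rho supp); first by exists rho.
apply: ge_ereal_sup => _ [I [x [r [[xr pack] ->]]]].
apply: le_trans (measure_packing_le nu _ pack); last by [].
by apply: le_esum => i /xr[Sx rr]; exact: term.
Qed.

(** The balls of a covering of the support carry the total mass of [nu]; below
    [t] the weights dominate these masses. *)
Lemma b_ge_gibbs q t : nu (~` supp) = 0%E -> gibbs_scaling q t ->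
  (t%:E <= b_dim mu q)%E.
Proof.
move=> nuS gibbs; rewrite leNgt; apply/negP => /ereal_between[s].
move=> /(b_dimP mu q s).2 H0; rewrite lte_fin => st.
have [rho rho0 term] := gibbs_term_ge gibbs st.
have : H_bar mu q s supp = 0%E.
  by apply/eqP; rewrite eq_le H_bar_ge0 andbT -H0 H_bar_le_mes.
move=> /H_bar_eq0P/(_ rho 2^-1 rho0); rewrite invr_gt0 => /(_ (ltr0Sn R 1)).
move=> [I [x [r [[xr cov]]]]]; apply/negP; rewrite -ltNge.
have mS := measurable_mixed_support mu.
have nuS1 : nu supp = 1%E.
  by rewrite -[X in nu X]setCK probability_setC ?nuS ?sube0//; exact: measurableC.
apply: (@lt_le_trans _ _ 1%E); first by rewrite lte_fin invf_lt1// ltr1n.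
rewrite -nuS1.
apply: le_trans (measure_cover_le nu (F := fun i => eball (x i) (r i)) mS _ cov) _.
  by [].
by apply: le_esum => i /xr[Sx rr]; exact: term.
Qed.

End auxiliary_measure.

(** * Slopes of convex functions, and the Gibbs scaling of nu *)
Section one_sided_limits.
Context {R : realType}.
Implicit Types (P : R -> Prop) (g : R -> R).

Lemma near_right0P P : (\forall r \near 0^'+, P r) <->
  exists2 rho, 0 < rho & forall r, 0 < r < rho -> P r.
Proof.
split=> [[e /= e0 eP]|[rho rho0 rhoP]].
  exists e => // r /andP[r0 re]; apply: eP => //=.
  by rewrite sub0r normrN gtr0_norm.
near=> r; apply: rhoP; apply/andP; split; near: r.
  exact: nbhs_right_gt.
exact: nbhs_right_lt.
Unshelve. all: by end_near. Qed.

Definition convex_at0 g := forall a b s, 0 < s < 1 ->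
  g ((1 - s) * a + s * b) <= (1 - s) * g a + s * g b.

(** Three cases, according to which of 0, [h1], [h2] lies between the other two:
    the convexity inequality at the middle point is the claim. *)
Lemma convex_slope_mono g h1 h2 : convex_at0 g -> g 0 = 0 ->
  h1 != 0 -> h2 != 0 -> h1 < h2 -> g h1 / h1 <= g h2 / h2.
Proof.
move=> gcvx g0 h1n h2n h12.
have [h10|h10] := ltP 0 h1.
  have h20 : 0 < h2 by exact: lt_trans h12.
  have s01 : 0 < h1 / h2 < 1 by rewrite divr_gt0//= ltr_pdivrMr// mul1r.
  have := gcvx 0 h2 _ s01; rewrite g0 !mulr0 !add0r divfK// => h.
  by rewrite ler_pdivrMr// mulrAC -mulrA mulrC.
have {}h10 : h1 < 0 by rewrite lt_neqAle h1n.
have [h20|h20] := ltP 0 h2.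
  have d0 : 0 < h2 - h1 by rewrite subr_gt0.
  have s01 : 0 < - h1 / (h2 - h1) < 1.
    by rewrite divr_gt0 ?oppr_gt0//= ltr_pdivrMr// mul1r; lra.
  have := gcvx h1 h2 _ s01; set s := - h1 / _.
  have -> : (1 - s) * h1 + s * h2 = 0 by rewrite /s; field; rewrite gt_eqF.
  rewrite g0 => h; rewrite ler_ndivrMr// mulrAC ler_pdivrMr//.
  have := mulr_ge0 (ltW d0) h.
  have -> : (h2 - h1) * ((1 - s) * g h1 + s * g h2) = h2 * g h1 - h1 * g h2.
    by rewrite /s; field; rewrite gt_eqF.
  lra.
have {}h20 : h2 < 0 by rewrite lt_neqAle h2n.
have s01 : 0 < h2 / h1 < 1.
  rewrite -mulrNN -invrN divr_gt0 ?oppr_gt0//= ltr_pdivrMr ?oppr_gt0// mul1r.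
  by rewrite ltrN2.
have := gcvx 0 h1 _ s01; rewrite g0 !mulr0 !add0r divfK// => h.
by rewrite ler_ndivlMr// mulrAC -mulrA mulrC.
Qed.

(** The slopes h |-> g h / h of a convex function vanishing at 0 increase, so
    that each one-sided family is bounded by any slope of the other side. *)
Lemma convex_slope_right g : convex_at0 g -> g 0 = 0 ->
  cvg (g h / h @[h --> 0^'+]).
Proof.
move=> gcvx g0; apply: nondecreasing_at_right_is_cvgr.
  near=> e => x y /=; rewrite !in_itv/= => /andP[x0 _] /andP[y0 _].
  rewrite le_eqVlt => /predU1P[->//|xy].
  by apply: convex_slope_mono => //; rewrite gt_eqF.
near=> e; exists (g (-1) / -1) => _ [h /= + <-]; rewrite in_itv/= => /andP[h0 _].
apply: convex_slope_mono => //; rewrite ?oppr_eq0 ?gt_eqF//.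
by apply: lt_trans h0; rewrite oppr_lt0.
Unshelve. all: by end_near. Qed.

Lemma convex_slope_left g : convex_at0 g -> g 0 = 0 ->
  cvg (g h / h @[h --> 0^'-]).
Proof.
move=> gcvx g0; apply: nondecreasing_at_left_is_cvgr.
  near=> e => x y /=; rewrite !in_itv/= => /andP[_ x0] /andP[_ y0].
  rewrite le_eqVlt => /predU1P[->//|xy].
  by apply: convex_slope_mono => //; rewrite lt_eqF.
near=> e; exists (g 1 / 1) => _ [h /= + <-]; rewrite in_itv/= => /andP[_ h0].
apply: convex_slope_mono => //; rewrite ?oner_eq0 ?lt_eqF//.
exact: lt_trans h0 _.
Unshelve. all: by end_near. Qed.

End one_sided_limits.

Section gibbs_from_ratio.
Context {R : realType} {d k : nat}.
Variable mu : 'I_k -> probability (borel_space R d) R.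
Variable nu : probability (borel_space R d) R.

(** In logarithmic scale the two constants and the o(log r) correction [phi]
    are all absorbed by eps |log (2 r)|. *)
Lemma gibbs_scalingP q t (r_q Kl Ku : R) (phi : R -> R^o) :
  0 < r_q -> 0 < Kl -> 0 < Ku ->
  phi =o_ (0^'+) (@ln R : R -> R^o) ->
  (forall x r, mixed_support mu x -> 0 < r < r_q ->
     Kl <= fine (nu (eball x r)) /
       (fine (ball_pow mu q x r) * (2 * r) `^ t * expR (phi r)) <= Ku) ->
  gibbs_scaling mu nu q t.
Proof.
move=> rq0 Kl0 Ku0 /eqoP phio A1 eps eps0.
pose M := `|ln Kl| + `|ln Ku|.
have e40 : 0 < eps / 4 by rewrite divr_gt0.
have /near_right0P[rho1 rho10 phib] := phio _ e40.
(* Below 1/4, |log r| <= 2 |log (2 r)|, which leaves eps / 2 |log r| for [phi]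
   and for the constants; the last bound makes the constants smaller than
   eps / 4 |log r|. *)
exists (Num.min (Num.min r_q rho1) (Num.min 4^-1 (expR (- (M * 4 / eps))))).
  by rewrite !lt_min rq0 rho10 invr_gt0 expR_gt0 ltr0n.
move=> x r Sx; rewrite !lt_min => /and4P[r0 /andP[rq r1] r4 re].
have lnr2 : ln r <= - (ln 2 + ln 2).
  rewrite -lnM ?posrE//.
  by rewrite -lnV ?posrE ?mulr_gt0// ler_ln ?posrE ?invr_gt0 ?mulr_gt0// -natrM ltW.
have lnrM : ln r <= - (M * 4 / eps).
  by rewrite -[leRHS]expRK ler_ln ?posrE ?expR_gt0// ltW.
have ln2r : ln (2 * r) = ln 2 + ln r by rewrite lnM ?posrE.
have r21 : 2 * r < 1.
  by rewrite mulrC -ltr_pdivlMr// (lt_trans r4)// div1r ltf_pV2 ?posrE// ltr_nat.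
have := A1 x r Sx; rewrite r0 rq => /(_ isT).
have -> : fine (ball_pow mu q x r) * (2 * r) `^ t =
    expR (inner q (log_masses mu x r) + t * ln (2 * r)).
  by rewrite ball_powE//= expRD /powR gt_eqF// mulr_gt0.
rewrite -expRD; set S := inner q _ + _; set v := fine _.
rewrite ler_pdivlMr ?expR_gt0// ler_pdivrMr ?expR_gt0// => /andP[vl vu].
have v0 : 0 < v by apply: lt_le_trans vl; rewrite mulr_gt0// expR_gt0.
split=> //.
have {}vl : ln Kl + (S + phi r) <= ln v.
  rewrite -[X in ln Kl + X]expRK -lnM ?posrE ?expR_gt0//.
  by rewrite ler_ln ?posrE// mulr_gt0// expR_gt0.
have {}vu : ln v <= ln Ku + (S + phi r).
  rewrite -[X in ln Ku + X]expRK -lnM ?posrE ?expR_gt0//.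
  by rewrite ler_ln ?posrE// mulr_gt0// expR_gt0.
have phir : `|phi r| <= eps / 4 * `|ln r| by apply: phib; rewrite r0 r1.
have ln20 : 0 < ln (2 : R) by rewrite ln_gt0// ltr1n.
have lnr0 : ln r < 0 by lra.
rewrite (ltr0_norm lnr0) in phir.
move: phir; rewrite ler_norml => /andP[p1 p2].
have Ml : - M <= ln Kl.
  by rewrite lerNl (le_trans (ler_norm _))// normrN lerDl.
have Mu : ln Ku <= M by rewrite (le_trans (ler_norm _))// lerDr.
have Me : M <= eps / 4 * - ln r.
  rewrite mulrAC ler_pdivlMr// mulrN lerNr.
  by rewrite -ler_pdivlMl// mulrC mulNr.
rewrite ln2r ler_norml.
have h1 : eps / 2 * - ln r <= - (eps * (ln 2 + ln r)).
  rewrite -mulrN -mulrA ler_pM2l//; lra.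
by apply/andP; split; lra.
Qed.

End gibbs_from_ratio.

(** * Growth rate of the moments *)
Section moments.
Context {R : realType} {d k : nat}.
Variable mu : 'I_k -> probability (borel_space R d) R.
Local Notation supp := (mixed_support mu).
Variable nu : probability (borel_space R d) R.
Hypothesis nu_supported : nu (~` supp) = 0%E.
Variable r_ : nat -> R.
Hypothesis r_in01 : forall n, 0 < r_ n < 1.
Variable C : 'rV[R]_k -> R^o.
Hypothesis log_moment_cvg : forall p : 'rV[R]_k,
  log_moment mu nu (r_ n) p @[n --> \oo] --> (C p)%:E.
Implicit Types (p a b : 'rV[R]_k) (c : R).

Let r_gt0 n : 0 < r_ n. Proof. by have /andP[] := r_in01 n. Qed.

Let s_gt0 n : 0 < - ln (r_ n).
Proof. by have /andP[r0 r1] := r_in01 n; rewrite oppr_gt0 ln_lt0// r0. Qed.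

Definition ball_moment p r : \bar R :=
  (\int[nu]_(x in supp) (expR (inner p (log_masses mu x r)))%:E)%E.

Lemma nu_support1 : nu supp = 1%E.
Proof.
have mS := measurable_mixed_support mu.
rewrite -[X in nu X]setCK probability_setC ?nu_supported ?sube0//.
exact: measurableC.
Qed.

Lemma ball_moment_ge0 p r : (0 <= ball_moment p r)%E.
Proof. by apply: integral_ge0 => x _; rewrite lee_fin expR_ge0. Qed.

Lemma log_momentE p r : 0 < r ->
  log_moment mu nu r p = (((- ln r)^-1)%:E * lne (ball_moment p r))%E.
Proof.
move=> r0; rewrite /log_moment; congr (_ * lne _)%E.
by apply: eq_integral => x; rewrite inE => Sx; rewrite ball_powE.
Qed.

Lemma measurable_expR_log_masses (D : set (borel_space R d)) p r c :
  measurable D ->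
  measurable_fun D
    (fun x : borel_space R d => (expR (inner p (log_masses mu x r) + c))%:E).
Proof.
move=> mD; apply/measurable_EFinP; apply: measurable_funTS.
apply: measurableT_comp; first exact: measurable_expR.
by apply: measurable_funD => //; exact: measurable_inner_log_masses.
Qed.

Lemma ball_moment_lt p c : C p < c ->
  \forall n \near \oo, (ball_moment p (r_ n) < (expR (c * - ln (r_ n)))%:E)%E.
Proof.
move=> Cc; have : nbhs (C p)%:E (fun u : \bar R => (u < c%:E)%E).
  by apply: open_ereal_lt'; rewrite lte_fin.
move=> /log_moment_cvg cvgp.
have : \forall n \near \oo, (log_moment mu nu (r_ n) p < c%:E)%E by exact: cvgp.
apply: filterS => n; rewrite log_momentE// lte_pdivrMl// -EFinM mulrC => h.
have /eqP <- : expeR (lne (ball_moment p (r_ n))) == ball_moment p (r_ n).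
  by rewrite lneK_eq ball_moment_ge0.
by rewrite -[X in (_ < X)%E]/(expeR (c * - ln (r_ n))%:E) lte_expeR.
Qed.

Lemma ball_moment_scale p r c : ((expR c)%:E * ball_moment p r =
  \int[nu]_(x in supp) (expR (inner p (log_masses mu x r) + c))%:E)%E.
Proof.
have mS := measurable_mixed_support mu.
rewrite /ball_moment -ge0_integralZl_EFin ?expR_ge0//.
- by apply: eq_integral => x _; rewrite -EFinM expRD mulrC.
- have := @measurable_expR_log_masses supp p r 0 mS.
  by under eq_fun do rewrite addr0.
Qed.

(** The graph of exp lies above its tangent at the barycenter. *)
Lemma expR_convex (u v s : R) : 0 <= s <= 1 ->
  expR ((1 - s) * u + s * v) <= (1 - s) * expR u + s * expR v.
Proof.
move=> /andP[s0 s1]; set w := (1 - s) * u + s * v.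
have -> : expR u = expR w * expR (u - w) by rewrite -expRD addrC subrK.
have -> : expR v = expR w * expR (v - w) by rewrite -expRD addrC subrK.
rewrite !(mulrCA _ (expR w)) -mulrDr ler_peMr ?expR_ge0//.
have s1' : 0 <= 1 - s by rewrite subr_ge0.
apply: (@le_trans _ _ ((1 - s) * (1 + (u - w)) + s * (1 + (v - w)))).
  by rewrite le_eqVlt; apply/orP; left; apply/eqP; rewrite /w; ring.
by apply: lerD; apply: ler_wpM2l => //; exact: expR_ge1Dx.
Qed.

(** This is the inequality of Hoelder at the exponential scale: normalised by
    its own growth rate, each of the two moments becomes at most 1, and the
    convexity of exp bounds the moment of the convex combination by 1. *)
Lemma moment_rate_convex a b s : 0 < s < 1 ->
  C ((1 - s) *: a + s *: b) <= (1 - s) * C a + s * C b.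
Proof.
move=> /andP[s0 s1]; apply/ler_addgt0Pr => e e0.
set p := _ + _; rewrite leNgt; apply/negP => Cp.
(* The growth rates of the two moments are replaced by slightly larger numbers,
   so that they are eventually valid bounds. *)
pose ca := C a + e; pose cb := C b + e; pose c := (1 - s) * ca + s * cb.
have Cpc : c < C p.
  by apply: le_lt_trans Cp; rewrite /c /ca /cb; lra.
have mS := measurable_mixed_support mu.
have Caa : C a < ca by rewrite ltrDl.
have Cbb : C b < cb by rewrite ltrDl.
near \oo => n.
have Ha0 : (ball_moment a (r_ n) < (expR (ca * - ln (r_ n)))%:E)%E.
  by near: n; exact: ball_moment_lt.
have Hb0 : (ball_moment b (r_ n) < (expR (cb * - ln (r_ n)))%:E)%E.
  by near: n; exact: ball_moment_lt.
have : (c%:E < log_moment mu nu (r_ n) p)%E.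
  near: n; have : nbhs (C p)%:E (fun u : \bar R => (c%:E < u)%E).
    by apply: open_ereal_gt'; rewrite lte_fin.
  by move=> /log_moment_cvg.
rewrite log_momentE// lte_pdivlMl// -EFinM; apply/negP; rewrite -leNgt.
set L := - ln (r_ n) in Ha0 Hb0 *; set r := r_ n in Ha0 Hb0 *.
have Ha : ((expR (- (ca * L)))%:E * ball_moment a r <= 1)%E.
  by rewrite expRN lee_pdivrMl ?expR_gt0// mule1 ltW.
have Hb : ((expR (- (cb * L)))%:E * ball_moment b r <= 1)%E.
  by rewrite expRN lee_pdivrMl ?expR_gt0// mule1 ltW.
have : ((expR (- (c * L)))%:E * ball_moment p r <= 1)%E.
  have <- : ((1 - s)%:E * 1 + s%:E * 1 = 1 :> \bar R)%E.
    by rewrite !mule1 -EFinD subrK.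
  apply: le_trans (leeD (lee_wpmul2l _ Ha) (lee_wpmul2l _ Hb)); last 2 first.
  - by rewrite lee_fin subr_ge0 ltW.
  - by rewrite lee_fin ltW.
  have s1' : 0 <= 1 - s by rewrite subr_ge0 ltW.
  rewrite !ball_moment_scale -!ge0_integralZl_EFin ?(ltW s0)//; last 2 first.
  - exact: measurable_expR_log_masses.
  - exact: measurable_expR_log_masses.
  rewrite -ge0_integralD//=; first last.
  - apply: emeasurable_funM => //; exact: measurable_expR_log_masses.
  - by move=> x _; rewrite -EFinM lee_fin mulr_ge0 ?expR_ge0// ltW.
  - apply: emeasurable_funM => //; exact: measurable_expR_log_masses.
  - by move=> x _; rewrite -EFinM lee_fin mulr_ge0 ?expR_ge0.
  apply: ge0_le_integral => //.
  - exact: measurable_expR_log_masses.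
  - apply: emeasurable_funD; apply: emeasurable_funM => //;
      exact: measurable_expR_log_masses.
  - move=> x _; rewrite -!EFinM -EFinD lee_fin.
    rewrite [X in expR X <= _](_ : _ = (1 - s) *
      (inner a (log_masses mu x r) - ca * L) + s *
      (inner b (log_masses mu x r) - cb * L)).
      by apply: expR_convex; rewrite !ltW.
    by rewrite /p innerDl !innerZl /c; ring.
rewrite expRN lee_pdivrMl ?expR_gt0// mule1 => h.
rewrite -lee_expeR (eqP (_ : expeR _ == ball_moment p r)) ?lneK_eq//.
  by rewrite (le_trans h)//= mulrC.
exact: ball_moment_ge0.
Unshelve. all: by end_near. Qed.

(** At [p = 0] the moment is the [nu]-mass of the support. *)
Lemma moment_rate0 : C 0 = 0.
Proof.
have logm0 n : log_moment mu nu (r_ n) 0 = 0%E.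
  rewrite log_momentE// /ball_moment.
  under eq_integral do rewrite inner0l expR0.
  rewrite integral_cst; last exact: measurable_mixed_support.
  by rewrite mul1e [X in lne X]nu_support1 lne1 mule0.
have := @log_moment_cvg 0; under eq_fun do rewrite logm0.
by move=> /cvg_lim; rewrite lim_cst// => /(_ (@ereal_hausdorff R)) [].
Qed.

Lemma moment_rate_line_convex p : convex_at0 (fun h => C (h *: p)).
Proof.
move=> x y s s01; rewrite scalerDl -!scalerA; exact: moment_rate_convex.
Qed.

End moments.

(** * Local dimensions along sparse radii *)
Section limf_real.
Context {R : realType}.
Implicit Types (f : R -> R) (l : R).

Lemma limf_einf_geP f l : (l%:E <= limf_einf (EFin \o f) 0^'+)%E <->
  forall e, 0 < e -> \forall r \near 0^'+, l - e <= f r.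
Proof.
rewrite limf_einfE; split=> [lf e e0|lf].
  have : ((l - e)%:E <
      ereal_sup [set ereal_inf ((EFin \o f) @` V) | V in 0^'+])%E.
    by apply: lt_le_trans lf; rewrite lte_fin ltrBlDr ltrDl.
  move=> /ereal_sup_gt[_ [V V0 <-]] lV; apply: filterS V0 => r Vr.
  rewrite -lee_fin; apply: le_trans (ltW lV) _; apply: ereal_inf_lbound.
  by exists r.
apply/lee_addgt0Pr => e e0; have Ve := lf e e0.
rewrite -leeBlDr//; apply: ereal_sup_ge.
exists (ereal_inf ((EFin \o f) @` [set r | l - e <= f r])).
  by exists [set r | l - e <= f r].
by apply: le_ereal_inf_tmp => _ [r /= lr <-]; rewrite -EFinB lee_fin.
Qed.

Lemma limf_esup_leP f l : (limf_esup (EFin \o f) 0^'+ <= l%:E)%E <->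
  forall e, 0 < e -> \forall r \near 0^'+, f r <= l + e.
Proof.
have -> : limf_esup (EFin \o f) 0^'+ = (- limf_einf (EFin \o (fun r => - f r)%R) 0^'+)%E.
  rewrite -limf_esupN; congr limf_esup; apply/funext => r /=.
  by rewrite opprK.
rewrite leeNl -EFinN limf_einf_geP.
by split=> h e /h; apply: filterS => r /=; rewrite -opprD lerN2.
Qed.

End limf_real.

Section local_dimensions.
Context {R : realType} {d k : nat}.
Variable mu : 'I_k -> probability (borel_space R d) R.
Implicit Types (x : 'rV[R]_d) (alpha : R).

Let near_ln_lt0 : \forall r \near (0 : R)^'+, 0 < r /\ ln r < 0.
Proof.
apply/near_right0P; exists 1 => // r /andP[r0 r1].
by rewrite ln_lt0// r0.
Qed.

Lemma lower_local_dimP (j : 'I_k) x alpha :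
  (alpha%:E <= lower_local_dim mu j x)%E <-> forall e, 0 < e ->
    \forall r \near 0^'+, log_masses mu x r 0 j <= (alpha - e) * ln r.
Proof.
rewrite (limf_einf_geP (fun r => ln (fine (mu j (eball x r))) / ln r)).
split=> h e /h {}h; move: near_ln_lt0; apply: filterS2 h => r h [r0 lnr0];
  by move: h; rewrite mxE ler_ndivlMr.
Qed.

Lemma upper_local_dimP (j : 'I_k) x alpha :
  (upper_local_dim mu j x <= alpha%:E)%E <-> forall e, 0 < e ->
    \forall r \near 0^'+, (alpha + e) * ln r <= log_masses mu x r 0 j.
Proof.
rewrite (limf_esup_leP (fun r => ln (fine (mu j (eball x r))) / ln r)).
split=> h e /h {}h; move: near_ln_lt0; apply: filterS2 h => r h [r0 lnr0];
  by move: h; rewrite mxE ler_ndivrMr.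
Qed.

End local_dimensions.

Section sparse_radii.
Context {R : realType}.
Variable r_ : nat -> R.
Hypothesis r_in01 : forall n, 0 < r_ n < 1.
Hypothesis r_decr : forall m n, (m <= n)%N -> r_ n <= r_ m.
Hypothesis r_to0 : r_ n @[n --> \oo] --> (0 : R).
Hypothesis r_ratio : ln (r_ n.+1) / ln (r_ n) @[n --> \oo] --> (1 : R).

(** The index [n] is the predecessor of the first one at which [r_ n < r]. *)
Lemma bracket n0 : \forall r \near 0^'+, exists n,
  [/\ (n0 <= n)%N, r_ n.+1 < r & r <= r_ n].
Proof.
apply/near_right0P; exists (r_ n0); first by have /andP[] := r_in01 n0.
move=> r /andP[r0 rn0].
have [N rN] : exists n, r_ n < r.
  have [N _ /(_ N (leqnn N)) rN] := cvgr_lt _ r_to0 _ r0.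
  by exists N.
have exN : exists n, r_ n < r by exists N.
case: (ex_minnP exN) => -[|m] rm mmin.
  by have := lt_le_trans (lt_trans rm rn0) (r_decr (leq0n n0)); rewrite ltxx.
have rm' : r <= r_ m by rewrite leNgt; apply/negP => /mmin; rewrite ltnn.
exists m; split=> //; rewrite -ltnS ltnNge; apply/negP => /r_decr rm0.
by have := lt_trans (le_lt_trans rm0 rm) rn0; rewrite ltxx.
Qed.

Lemma near_ratio_le (c : R) : 1 < c ->
  \forall n \near \oo, - ln (r_ n.+1) <= c * - ln (r_ n).
Proof.
move=> c1; have : \forall n \near \oo, ln (r_ n.+1) / ln (r_ n) <= c.
  exact: (cvgr_le _ r_ratio c c1).
apply: filterS => n.
by rewrite ler_ndivrMr ?ln_lt0// !mulrN lerN2.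
Qed.

(** A nondecreasing function of the radius that is compared with log r along
    the radii [r_ n] is compared with it at all small radii: the two ends of
    the interval containing r have equivalent logarithms. *)
Lemma interpolate_upper (f : R -> R) (s1 s : R) : s1 < s ->
  (forall r, f r <= 0) -> (forall r r', 0 < r -> r <= r' -> f r <= f r') ->
  (\forall n \near \oo, f (r_ n) < s1 * - ln (r_ n)) ->
  \forall r \near 0^'+, f r <= - s * ln r.
Proof.
move=> s1s f0 fmono fr; have [s0|s0] := leP 0 s.
  apply/near_right0P; exists 1 => // r r01; apply: le_trans (f0 r) _.
  by rewrite mulNr -mulrN mulr_ge0// oppr_ge0 ltW// ln_lt0.
have c1 : 1 < s1 / s by rewrite ltr_ndivlMr// mul1r.
have [n0 _ hn0] : \forall n \near \oo,
    f (r_ n) < s1 * - ln (r_ n) /\ - ln (r_ n.+1) <= s1 / s * - ln (r_ n).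
  by near=> n; split; near: n => //; exact: near_ratio_le.
move: (bracket n0); apply: filterS2 (nbhs_right_gt (0 : R)) => r r0.
move=> [n [n0n rn1 rn]]; have [fn ln_n] := hn0 n n0n.
apply: le_trans (fmono _ _ r0 rn) _; apply: le_trans (ltW fn) _.
apply: (@le_trans _ _ (s * - ln (r_ n.+1))).
  have -> : s1 * - ln (r_ n) = s * (s1 / s * - ln (r_ n)).
    by field; rewrite lt_eqF.
  by rewrite ler_wnM2l// ltW.
rewrite mulNr -mulrN ler_wnM2l ?(ltW s0)// lerN2 ler_ln ?posrE ?(ltW rn1)//.
by have /andP[] := r_in01 n.+1.
Unshelve. all: by end_near. Qed.

Lemma interpolate_lower (f : R -> R) (s s1 : R) : s < s1 ->
  (forall r, f r <= 0) -> (forall r r', 0 < r -> r <= r' -> f r <= f r') ->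
  (\forall n \near \oo, s1 * - ln (r_ n) < f (r_ n)) ->
  \forall r \near 0^'+, - s * ln r <= f r.
Proof.
move=> ss1 f0 fmono fr.
have s10 : s1 < 0.
  have [n _ /(_ n (leqnn n)) fn] := fr.
  have := lt_le_trans fn (f0 _); rewrite pmulr_llt0// oppr_gt0 ln_lt0//.
have s0 : s < 0 by exact: lt_trans s10.
have c1 : 1 < s / s1 by rewrite ltr_ndivlMr// mul1r.
have [n0 _ hn0] : \forall n \near \oo,
    s1 * - ln (r_ n) < f (r_ n) /\ - ln (r_ n.+1) <= s / s1 * - ln (r_ n).
  by near=> n; split; near: n => //; exact: near_ratio_le.
move: (bracket n0); apply: filterS2 (nbhs_right_gt (0 : R)) => r r0.
move=> [n [n0n rn1 rn]]; have [_ ln_n] := hn0 n n0n.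
have [fn _] := hn0 n.+1 (leqW n0n).
have rn10 : 0 < r_ n.+1 by have /andP[] := r_in01 n.+1.
apply: le_trans (fmono _ _ rn10 (ltW rn1)); apply: le_trans (ltW fn).
apply: (@le_trans _ _ (s * - ln (r_ n))).
  rewrite mulNr -mulrN ler_wnM2l ?(ltW s0)// lerN2 ler_ln ?posrE//.
  exact: lt_le_trans rn.
have -> : s * - ln (r_ n) = s1 * (s / s1 * - ln (r_ n)).
  by field; rewrite lt_eqF.
by rewrite ler_wnM2l// ltW.
Unshelve. all: by end_near. Qed.

End sparse_radii.

(** * Large deviations: almost sure local dimensions *)
Section almost_sure_local_dimensions.
Context {R : realType} {d k : nat}.
Variable mu : 'I_k -> probability (borel_space R d) R.
Local Notation supp := (mixed_support mu).
Variable nu : probability (borel_space R d) R.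
Hypothesis nu_supported : nu (~` supp) = 0%E.
Variable r_ : nat -> R.
Hypothesis r_in01 : forall n, 0 < r_ n < 1.
Hypothesis r_decr : forall m n, (m <= n)%N -> r_ n <= r_ m.
Hypothesis r_to0 : r_ n @[n --> \oo] --> (0 : R).
Hypothesis r_ratio : ln (r_ n.+1) / ln (r_ n) @[n --> \oo] --> (1 : R).
Hypothesis r_summable : forall eps : R, 0 < eps ->
  cvgn (series (fun n => r_ n `^ eps)).
Variable C : 'rV[R]_k -> R^o.
Hypothesis log_moment_cvg : forall p : 'rV[R]_k,
  log_moment mu nu (r_ n) p @[n --> \oo] --> (C p)%:E.
Implicit Types (p a b : 'rV[R]_k) (c : R) (j : 'I_k).

Lemma measurable_exceedance p r c : measurable
  (supp `&` [set x | c <= inner p (log_masses mu x r)] : set (borel_space R d)).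
Proof.
apply: measurableI; first exact: measurable_mixed_support.
have := @measurable_inner_log_masses _ _ _ mu p r measurableT `[c, +oo[%classic.
rewrite setTI => /(_ (measurable_itv _)).
by congr measurable; apply/seteqP; split=> x /=; rewrite in_itv/= andbT.
Qed.

Lemma markov_ball_moment p r c :
  (nu (supp `&` [set x | (c <= inner p (log_masses mu x r))%R]) <=
   (expR (- c))%:E * ball_moment mu nu p r)%E.
Proof.
have mS := measurable_mixed_support mu.
have mA := measurable_exceedance p r c; set A := (_ `&` _) in mA *.
rewrite expRN lee_pdivlMl ?expR_gt0// -integral_cst//.
have mf : measurable_fun (supp : set (borel_space R d))
    (fun x : borel_space R d => (expR (inner p (log_masses mu x r)))%:E).
  have := @measurable_expR_log_masses _ _ _ mu supp p r 0 mS.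
  by under eq_fun do rewrite addr0.
apply: (@le_trans _ _ (\int[nu]_(x in A) (expR (inner p (log_masses mu x r)))%:E)%E).
  apply: ge0_le_integral => //.
  - by move=> x _; rewrite lee_fin expR_ge0.
  - by apply: measurable_funS mf => // x [].
  - by move=> x [_ /= cx]; rewrite lee_fin ler_expR.
by apply: ge0_subset_integral => // x [].
Qed.

(** Markov's inequality bounds the exceptional set at radius [r_ n] by a
    positive power of [r_ n], and these powers are summable. *)
Lemma moment_tail p c : C p < c -> nu.-negligible
  [set x | supp x /\ ~ \forall n \near \oo,
     inner p (log_masses mu x (r_ n)) < c * - ln (r_ n)].
Proof.
move=> Cc; have mS := measurable_mixed_support mu.
(* A rate strictly between leaves the positive exponent c - c' for the sum. *)
pose c' := (C p + c) / 2; have Cc' : C p < c' by rewrite /c'; lra.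
have c'c : 0 < c - c' by rewrite /c'; lra.
have [n0 _ hn0] := ball_moment_lt r_in01 log_moment_cvg Cc'.
(* The moment bound holds from [n0] on only; the earlier events are discarded,
   which does not affect the upper limit of the sequence. *)
pose bad n := supp `&`
  [set x | c * - ln (r_ n) <= inner p (log_masses mu x (r_ n))].
pose F n : set (borel_space R d) := if (n0 <= n)%N then bad n else set0.
have mF n : measurable (F n).
  by rewrite /F; case: ifP => // _; exact: measurable_exceedance.
have nuF n : (nu (F n) <= (r_ n `^ (c - c'))%:E)%E.
  rewrite /F; case: ifP => [n0n|_]; last by rewrite measure0 lee_fin powR_ge0.
  apply: le_trans (markov_ball_moment _ _ _) _.
  apply: le_trans (lee_wpmul2l _ (ltW (hn0 n n0n))) _.
    by rewrite lee_fin expR_ge0.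
  have /andP[rn0 _] := r_in01 n.
  rewrite -EFinM lee_fin -expRD /powR gt_eqF//.
  by rewrite le_eqVlt; apply/orP; left; apply/eqP; congr expR; ring.
exists (lim_sup_set F); split.
- by apply: bigcap_measurable => // n _; exact: bigcup_measurable.
- apply: lim_sup_set_cvg0 => //.
  apply: (@le_lt_trans _ _ (\sum_(n <oo) (r_ n `^ (c - c'))%:E)%E).
    by apply: lee_nneseries => // n _; exact: nuF.
  rewrite (_ : (\sum_(n <oo) _)%E =
      (limn (series (fun n => r_ n `^ (c - c'))))%:E) ?ltry//.
  rewrite -EFin_lim; last exact: r_summable.
  by congr (lim (_ @ \oo)); apply/funext => n /=; rewrite sumEFin.
- move=> x [Sx notev] n _; apply: contrapT => notF; apply: notev.
  exists (maxn n n0) => // m /=; rewrite geq_max => /andP[nm n0m].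
  rewrite ltNge; apply/negP => bm; apply: notF; exists m => //.
  by rewrite /F n0m.
Qed.

Lemma negligible_forall_nat (P : nat -> set (borel_space R d)) :
  (forall n, nu.-negligible [set x | supp x /\ ~ P n x]) ->
  nu.-negligible [set x | supp x /\ ~ forall n, P n x].
Proof.
move=> nP; apply: negligibleS (negligible_bigcup nP) => x [Sx /existsNP[n Pn]].
by exists n.
Qed.

(** Indices in ['I_k] are read as natural numbers, with a trivial condition at
    the numbers that are at least [k]. *)
Lemma negligible_forall_ord (P : 'I_k -> set (borel_space R d)) :
  (forall j, nu.-negligible [set x | supp x /\ ~ P j x]) ->
  nu.-negligible [set x | supp x /\ ~ forall j, P j x].
Proof.
move=> nP; pose Q n : set (borel_space R d) :=
  [set x | if insub n is Some j then P j x else True].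
have nQ : nu.-negligible [set x | supp x /\ ~ forall n, Q n x].
  apply: negligible_forall_nat => n; rewrite /Q /=; case: insubP => [j _ _|_].
    exact: nP.
  by apply: negligibleS (negligible_set0 nu) => x [].
apply: negligibleS nQ => x [Sx nPx]; split=> // Qx; apply: nPx => j.
by have := Qx j; rewrite /Q/= valK.
Qed.

Let slope j h := C (h *: delta_mx 0 j) / h.

Let diff_quotientE j h : diff_quotient C 0 j h = slope j h.
Proof.
have C0 := moment_rate0 nu_supported r_in01 log_moment_cvg.
by rewrite /diff_quotient add0r C0 subr0.
Qed.

Let slope_convex j : convex_at0 (fun h => C (h *: delta_mx 0 j)).
Proof. exact (moment_rate_line_convex r_in01 log_moment_cvg (delta_mx 0 j)). Qed.

Let C00 j : C (0 *: delta_mx 0 j) = 0.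
Proof. by rewrite scale0r (moment_rate0 nu_supported r_in01 log_moment_cvg). Qed.

Lemma right_grad_cvg j : slope j h @[h --> 0^'+] --> right_grad C 0 0 j.
Proof.
have dqE : diff_quotient C 0 j = slope j.
  by apply/funext => h; exact: diff_quotientE.
rewrite mxE dqE.
exact: convex_slope_right (slope_convex j) (C00 j).
Qed.

Lemma left_grad_cvg j : slope j h @[h --> 0^'-] --> left_grad C 0 0 j.
Proof.
have dqE : diff_quotient C 0 j = slope j.
  by apply/funext => h; exact: diff_quotientE.
rewrite mxE dqE.
exact: convex_slope_left (slope_convex j) (C00 j).
Qed.

(** The tail estimate for a small positive multiple of the basis vector, chosen
    so that the slope of [C] is below [s]. *)
Lemma right_tail j s : right_grad C 0 0 j < s -> nu.-negligible
  [set x | supp x /\ ~ \forall n \near \oo,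
     log_masses mu x (r_ n) 0 j < s * - ln (r_ n)].
Proof.
move=> js; have [h h0] : exists2 h, 0 < h & slope j h < s.
  have sl : \forall h \near 0^'+, slope j h < s.
    exact: (cvgr_lt _ (@right_grad_cvg j) _ js).
  near (0 : R)^'+ => h; exists h; near: h => //; exact: nbhs_right_gt.
rewrite /slope ltr_pdivrMr// => /moment_tail; apply: negligibleS.
move=> x [Sx H]; split=> // E; apply: H; apply: filterS E => n.
by rewrite innerZl inner_delta mulrC (mulrAC s) ltr_pM2r.
Unshelve. all: by end_near. Qed.

(** Same as [right_tail] with a negative multiple: moments of negative order
    control small masses. *)
Lemma left_tail j s : s < left_grad C 0 0 j -> nu.-negligible
  [set x | supp x /\ ~ \forall n \near \oo,
     s * - ln (r_ n) < log_masses mu x (r_ n) 0 j].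
Proof.
move=> js; have [h h0] : exists2 h, h < 0 & s < slope j h.
  have sl : \forall h \near 0^'-, s < slope j h.
    exact: (cvgr_gt _ (@left_grad_cvg j) _ js).
  near (0 : R)^'- => h; exists h; near: h => //; exact: nbhs_left_lt.
rewrite /slope ltr_ndivlMr// => /moment_tail; apply: negligibleS.
move=> x [Sx H]; split=> // E; apply: H; apply: filterS E => n.
by rewrite innerZl inner_delta mulrC (mulrAC s) ltr_nM2r.
Unshelve. all: by end_near. Qed.

(** The constraints on the local dimensions are countably many tail events: one
    for each coordinate, each side and each tolerance [m.+1%:R^-1]. *)
Lemma grad_level_set_full : nu.-negligible (supp `\`
  (X_lower mu (- right_grad C 0) `&` X_upper mu (- left_grad C 0))).
Proof.
pose Pr j m : set (borel_space R d) := [set x | \forall n \near \oo,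
  log_masses mu x (r_ n) 0 j < (right_grad C 0 0 j + m.+1%:R^-1) * - ln (r_ n)].
pose Pl j m : set (borel_space R d) := [set x | \forall n \near \oo,
  (left_grad C 0 0 j - m.+1%:R^-1) * - ln (r_ n) < log_masses mu x (r_ n) 0 j].
have Nr : nu.-negligible [set x | supp x /\ ~ forall j m, Pr j m x].
  apply: (negligible_forall_ord (P := fun j x => forall m, Pr j m x)) => j.
  apply: (negligible_forall_nat (P := Pr j)) => m.
  by apply: right_tail; rewrite ltrDl.
have Nl : nu.-negligible [set x | supp x /\ ~ forall j m, Pl j m x].
  apply: (negligible_forall_ord (P := fun j x => forall m, Pl j m x)) => j.
  apply: (negligible_forall_nat (P := Pl j)) => m.
  by apply: left_tail; rewrite ltrBlDr ltrDl.
apply: negligibleS (negligibleU Nr Nl) => x [Sx nX].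
apply: contrapT => /not_orP[/not_andP nr /not_andP nl].
have {nr} Hr : forall j m, Pr j m x by case: nr => // /contrapT.
have {nl} Hl : forall j m, Pl j m x by case: nl => // /contrapT.
have inv_lt (e : R) : 0 < e -> exists m : nat, m.+1%:R^-1 < e.
  move=> e0; have [m me] := ltr_add_invr e0 (y := 0).
  by exists m; rewrite add0r in me.
have fmono j r r' : 0 < r -> r <= r' ->
    log_masses mu x r 0 j <= log_masses mu x r' 0 j.
  exact: le_log_masses.
apply: nX; split; split=> // j.
- apply/lower_local_dimP => e e0; have [m me] := inv_lt e e0.
  rewrite mxE -opprD.
  apply: (interpolate_upper r_in01 r_decr r_to0 r_ratio _ _ (fmono j) (Hr j m)).
  - by rewrite ltrD2l.
  - by move=> r; exact: log_masses_le0.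
- apply/upper_local_dimP => e e0; have [m me] := inv_lt e e0.
  rewrite mxE -[_ + e]opprK opprD opprK.
  apply: (interpolate_lower r_in01 r_decr r_to0 r_ratio _ _ (fmono j) (Hl j m)).
  - by rewrite ltrD2l ltrN2.
  - by move=> r; exact: log_masses_le0.
Qed.

End almost_sure_local_dimensions.

(** * Hausdorff measures and the mass distribution principle *)
Section hausdorff_null_sets.
Context {R : realType} {n : nat}.
Implicit Types (A E U : set 'rV[R]_n) (x y : 'rV[R]_n) (s delta eta r : R).
Local Open Scope ereal_scope.

Lemma ediam_ge0 A : 0 <= ediam A.
Proof. by rewrite /ediam le_max lexx. Qed.

Lemma edist_le_ediam A x y : A x -> A y -> (edist x y)%:E <= ediam A.
Proof.
move=> Ax Ay; rewrite /ediam le_max; apply/orP; right.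
by apply: ereal_sup_ubound; exists (x, y).
Qed.

Lemma ediam_eball_le x r : (0 <= r)%R -> ediam (eball x r) <= (2 * r)%:E.
Proof.
move=> r0; rewrite /ediam ge_max lee_fin mulr_ge0//=.
apply: ge_ereal_sup => _ [[y z] [/= xy xz] <-] /=; rewrite lee_fin.
rewrite mulr2n mulrDl mul1r; apply: le_trans (edist_triangle x _ _) _.
by rewrite lerD// edistC.
Qed.

Lemma hausdorff_premeasure_ge0 s delta E : 0 <= hausdorff_premeasure s delta E.
Proof.
apply: le_ereal_inf_tmp => _ [I [U [_ _ ->]]].
by apply: esum_ge0 => i _; exact: poweR_ge0.
Qed.

Lemma hausdorff_measure_eq0P s E : hausdorff_measure s E = 0 <->
  forall delta eta, (0 < delta)%R -> (0 < eta)%R ->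
  exists (I : set nat) (U : nat -> set 'rV[R]_n),
    [/\ E `<=` \bigcup_(i in I) U i, forall i, I i -> ediam (U i) <= delta%:E &
        \esum_(i in I) poweR (ediam (U i)) s <= eta%:E].
Proof.
rewrite /hausdorff_measure lim_at_right_sup; last first.
  move=> r1 r2 _ r12; apply: ereal_inf_le_tmp => z [I [U [cov diam ->]]].
  exists I, U; split=> // i /diam Ui; apply: le_trans Ui _.
  by rewrite lee_fin.
split=> [H0 delta eta delta0 eta0|small].
  have : hausdorff_premeasure s delta E < eta%:E.
    apply: (@le_lt_trans _ _ 0); last by rewrite lte_fin.
    by rewrite -H0; apply: ereal_sup_ubound; exists delta.
  by move=> /ereal_inf_lt[_ [I [U [cov diam ->]]] /ltW]; exists I, U.
apply/eqP; rewrite eq_le; apply/andP; split.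
  apply: ge_ereal_sup => _ [delta delta0 <-]; apply/lee_addgt0Pr => eta eta0.
  rewrite add0e; have [I [U [cov diam le]]] := small _ _ delta0 eta0.
  apply: ge_ereal_inf; exists (\esum_(i in I) poweR (ediam (U i)) s) => //.
  by exists I, U.
apply: le_ereal_sup_tmp; exists (hausdorff_premeasure s 1%R E).
  by exists 1%R => /=.
exact: hausdorff_premeasure_ge0.
Qed.

End hausdorff_null_sets.

Section mass_distribution.
Context {R : realType} {n : nat}.
Variable nu : probability (borel_space R n) R.
Implicit Types (E X : set 'rV[R]_n) (x : 'rV[R]_n) (s rho : R).
Local Open Scope ereal_scope.

(** Made for sets of unknown measurability, such as level sets: the intersection
    of a sequence of the supersets [G] is a measurable null superset. *)
Lemma negligible_small E :
  (forall eta : R, (0 < eta)%R -> exists G : set (borel_space R n),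
     [/\ measurable G, E `<=` G & nu G <= eta%:E]) -> nu.-negligible E.
Proof.
move=> small; have : forall m : nat, exists G : set (borel_space R n),
    [/\ measurable G, E `<=` G & nu G <= (m.+1%:R^-1)%:E].
  by move=> m; apply: small.
move=> /choice[G GP]; exists (\bigcap_m G m); split.
- by apply: bigcap_measurable => // m _; have [] := GP m.
- apply/eqP; rewrite -measure_le0; apply/lee_addgt0Pr => e e0; rewrite add0e.
  have [m me] := ltr_add_invr e0 (y := 0%R); rewrite add0r in me.
  have [mG _ nuG] := GP m; apply: (@le_trans _ _ (nu (G m))).
    apply: le_measure; rewrite ?inE//; last by move=> x; apply.
    by apply: bigcap_measurable => // i _; have [] := GP i.
  by rewrite (le_trans nuG)// lee_fin ltW.
- by move=> x Ex m _; have [_ EG _] := GP m; exact: EG.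
Qed.

(** Mass distribution principle.  Every set of a cheap covering of [E] that
    meets [E] lies in a ball centered in [E] whose radius is the diameter of
    the set; the sum of the masses of these balls is therefore as small as the
    sum of the powers of the diameters. *)
Lemma mass_distribution s rho E : (0 <= s)%R -> (0 < rho)%R ->
  (forall x r, E x -> (0 < r < rho)%R -> nu (eball x r) <= (r `^ s)%:E) ->
  hausdorff_measure s E = 0 -> nu.-negligible E.
Proof.
move=> s0 rho0 nuE /hausdorff_measure_eq0P HE.
have nuE0 x (D : R) : E x -> (0 <= D < rho)%R -> nu (eball x D) <= (D `^ s)%:E.
  move=> Ex /andP[]; rewrite le_eqVlt => /predU1P[<- _|D0 Drho]; last first.
    by apply: nuE => //; rewrite D0.
  have [->|sn0] := eqVneq s 0%R; first by rewrite powRr0; exact: probability_le1.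
  (* A set of diameter zero: the decay of [nu] at small radii shows that the
     center has no mass. *)
  rewrite powR0//; apply/lee_addgt0Pr => e e0; rewrite add0e.
  have sgt0 : (0 < s)%R by rewrite lt_neqAle eq_sym sn0.
  have [e1 e10 small] := small_powR ler01 sgt0 e0.
  pose r := (Num.min (rho / 2) e1)%R.
  have r0 : (0 < r)%R by rewrite lt_min e10 divr_gt0.
  apply: (@le_trans _ _ (nu (eball x r))).
    by apply: le_measure; rewrite ?inE//; exact/le_eball/ltW.
  apply: (@le_trans _ _ (r `^ s)%:E).
    by apply: nuE; rewrite // r0 gt_min ltr_pdivrMr// mulr2n mulrDr mulr1 ltrDl rho0.
  have : (r <= e1)%R by rewrite ge_min lexx orbT.
  move=> /(small r r0); rewrite mulr1 => h; rewrite lee_fin; apply: le_trans h.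
  by rewrite ge0_ler_powR ?nnegrE ?mulr_ge0 ?(ltW r0)// ler_peMl ?(ltW r0)// ler1n.
apply: negligible_small => eta eta0.
have rho20 : (0 < rho / 2)%R by rewrite divr_gt0.
have [I [U [cov diam sumU]]] := HE (rho / 2)%R eta rho20 eta0.
pose x i := xget (0%R : 'rV[R]_n) (E `&` U i).
pose J := I `&` [set i | E `&` U i !=set0].
have xP i : J i -> E (x i) /\ U i (x i) by move=> [_ ne]; exact: (@xgetPex _ 0%R _ ne).
pose D i := fine (ediam (U i)).
have DE i : I i -> ediam (U i) = (D i)%:E.
  move=> /diam Ui; rewrite /D fineK// ge0_fin_numE ?ediam_ge0//.
  exact: le_lt_trans Ui (ltry _).
have Drho i : I i -> (0 <= D i < rho)%R.
  move=> Ii; rewrite fine_ge0 ?ediam_ge0//=.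
  have := diam i Ii; rewrite (DE i Ii) lee_fin => /le_lt_trans; apply.
  by rewrite ltr_pdivrMr// mulr2n mulrDr mulr1 ltrDl.
pose G : set (borel_space R n) := \bigcup_(i in J) eball (x i) (D i).
have mG : measurable G by apply: bigcup_measurable => i _.
exists G; split=> //.
  move=> y Ey; have [i Ii Uiy] := cov y Ey.
  have Ji : J i by split=> //; exists y.
  exists i => //; have [_ Uix] := xP i Ji.
  by have := edist_le_ediam Uix Uiy; rewrite (DE i Ii) lee_fin.
apply: le_trans (measure_cover_le nu (I := J) (F := fun i => eball (x i) (D i)) mG _ _) _.
- by move=> i.
- by [].
apply: (@le_trans _ _ (\esum_(i in J) poweR (ediam (U i)) s)).
  apply: le_esum => i Ji; have [Ex _] := xP i Ji; have [Ii _] := Ji.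
  by rewrite (DE i Ii) poweR_EFin; apply: nuE0 => //; exact: Drho.
apply: le_trans sumU; rewrite esum_mkcondr; apply: le_esum => i _.
by case: ifP => // _; exact: poweR_ge0.
Qed.

(** The decay of [nu] is only pointwise: [X] is a countable union of sets on
    which it is uniform, and not all of them can be negligible. *)
Lemma hausdorff_dim_ge X (sigma : R) : ~ nu.-negligible X ->
  (forall x s, X x -> (s < sigma)%R ->
     \forall r \near 0^'+, nu (eball x r) <= (r `^ s)%:E) ->
  sigma%:E <= hausdorff_dim X.
Proof.
move=> nuX decay; apply: le_ereal_inf_tmp => _ [s [s0 Hs] <-].
rewrite lee_fin leNgt; apply/negP => ssigma; apply: nuX.
pose Y m := X `&` [set x | forall r, (0 < r < m.+1%:R^-1)%R ->
  nu (eball x r) <= (r `^ s)%:E].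
have XY : X `<=` \bigcup_m Y m.
  move=> x Xx; have /near_right0P[rho rho0 rhoP] := decay x s Xx ssigma.
  have [m mrho] := ltr_add_invr rho0 (y := 0%R); rewrite add0r in mrho.
  exists m => //; split=> // r /andP[r0 rm]; apply: rhoP.
  by rewrite r0 (lt_trans rm).
have negY m : nu.-negligible (Y m).
  apply: (@mass_distribution s m.+1%:R^-1) => //.
    by move=> x r [_ Yx]; exact: Yx.
  apply/hausdorff_measure_eq0P => delta eta delta0 eta0.
  move/hausdorff_measure_eq0P : Hs => /(_ _ _ delta0 eta0)[I [U [cov diam le]]].
  by exists I, U; split=> // x [Xx _]; exact: cov.
by apply: (negligibleS _ (negligible_bigcup negY)) => x /XY.
Qed.

End mass_distribution.

(** * Dimension bounds on level sets *)
Section level_sets.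
Context {R : realType} {d k : nat}.
Variable mu : 'I_k -> probability (borel_space R d) R.
Local Notation supp := (mixed_support mu).
Implicit Types (x : 'rV[R]_d) (alpha p q : 'rV[R]_k) (t s beta e : R).

(** A lower bound on the local dimension at a coordinate where [q] is
    nonnegative, and an upper bound where it is nonpositive, both bound
    mu(B(x,r))^q from above. *)
Lemma inner_log_masses_le q alpha x :
  (forall j, (0 <= q 0 j /\ ((alpha 0 j)%:E <= lower_local_dim mu j x)%E) \/
             (q 0 j <= 0 /\ (upper_local_dim mu j x <= (alpha 0 j)%:E)%E)) ->
  forall e, 0 < e -> \forall r \near 0^'+,
    inner q (log_masses mu x r) <= (inner q alpha - e) * ln r.
Proof.
move=> qalpha e e0; have c0 : 0 < e / k.+1%:R by rewrite divr_gt0.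
have one : \forall r \near 0^'+, forall j, q 0 j * log_masses mu x r 0 j <=
    (q 0 j * alpha 0 j - e / k.+1%:R) * ln r.
  apply: filter_forall => j.
  have q1 : 0 < `|q 0 j| + 1 by rewrite ltr_wpDl.
  have e'0 : 0 < e / k.+1%:R / (`|q 0 j| + 1) by rewrite divr_gt0.
  have qe : `|q 0 j| * (e / k.+1%:R / (`|q 0 j| + 1)) <= e / k.+1%:R.
    by rewrite mulrA ler_pdivrMr// mulrC ler_wpM2l ?(ltW c0)// lerDl.
  set e' := e / _ / _ in e'0 qe.
  have nlnr0 : \forall r \near (0 : R)^'+, ln r < 0.
    by apply/near_right0P; exists 1 => // r; exact: ln_lt0.
  have [[q0 /lower_local_dimP/(_ e' e'0)]|[q0 /upper_local_dimP/(_ e' e'0)]] :=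
      qalpha j; apply: filterS2 nlnr0 => r lnr0 L.
    apply: le_trans (ler_wpM2l q0 L) _; rewrite mulrA ler_nM2r// mulrBr lerB//.
    by move: qe; rewrite ger0_norm.
  apply: le_trans (ler_wnM2l q0 L) _; rewrite mulrA ler_nM2r// mulrDr lerD//.
  by move: qe; rewrite ler0_norm// mulNr lerNl.
near=> r.
have r1 : ln r <= 0.
  by rewrite ln_le0//; near: r; exact: nbhs_right_le.
have H : forall j, q 0 j * log_masses mu x r 0 j <=
    (q 0 j * alpha 0 j - e / k.+1%:R) * ln r by near: r.
rewrite {1}/inner; apply: le_trans (ler_sum _ (fun j _ => H j)) _.
rewrite -mulr_suml sumrB ler_wnM2r// lerD2l lerN2 sumr_const card_ord.
rewrite -[leLHS]mulr_natr mulrAC ler_pdivrMr// ler_wpM2l ?(ltW e0)// ler_nat.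
exact: leqnSn.
Unshelve. all: by end_near. Qed.

(** Constants are negligible with respect to log r. *)
Lemma near_ln_absorb (a b c : R) : b < a -> \forall r \near 0^'+,
  a * ln r + c <= b * ln r.
Proof.
move=> ba; have ab : 0 < a - b by rewrite subr_gt0.
apply/near_right0P; exists (expR (- (`|c| / (a - b)))); first exact: expR_gt0.
move=> r /andP[r0 rc].
have : ln r <= - (`|c| / (a - b)).
  by rewrite -[leRHS]expRK ler_ln ?posrE ?expR_gt0// ltW.
rewrite lerNr ler_pdivrMr// => h; have := le_trans (ler_norm c) h; lra.
Qed.

(** Applying the upper bound to [- p] bounds mu(B(x,r))^p from below. *)
Lemma level_set_ball_term_ge p alpha t s x : X_level mu alpha x ->
  inner alpha p + t < s ->
  \forall r \near 0^'+,
    (((2 * r) `^ s)%:E <= ball_pow mu p x r * ((2 * r) `^ t)%:E)%E.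
Proof.
move=> [[Sx lower] [_ upper]] ts.
pose e := (s - (inner alpha p + t)) / 2.
have e0 : 0 < e by rewrite divr_gt0// subr_gt0.
have H : \forall r \near 0^'+,
    inner (- p) (log_masses mu x r) <= (inner (- p) alpha - e) * ln r.
  apply: inner_log_masses_le e0 => j; rewrite mxE.
  have [p0|p0] := leP (p 0 j) 0; [left|right]; split=> //.
  - by rewrite oppr_ge0.
  - by rewrite oppr_le0 ltW.
have st : inner alpha p + e < s - t by rewrite /e; lra.
near=> r.
have r0 : 0 < r by near: r; exact: nbhs_right_gt.
rewrite ball_term_expR// lee_fin /powR gt_eqF ?mulr_gt0//= ler_expR -lerBlDr.
rewrite -mulrBl lnM ?posrE// mulrDr [leLHS]addrC.
apply: (@le_trans _ _ ((inner alpha p + e) * ln r)).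
  by near: r; exact: near_ln_absorb.
have : inner (- p) (log_masses mu x r) <= (inner (- p) alpha - e) * ln r.
  by near: r.
rewrite !innerNl (innerC p alpha) -opprD mulNr lerN2; exact.
Unshelve. all: by end_near. Qed.

(** On the level set, mu(B(x,r))^p (2 r)^t dominates (2 r)^s as soon as
    s > <alpha,p> + t, so that a family which is cheap for the mixed measure is
    cheap for the Hausdorff measure of exponent s. *)
Lemma mixed_spectrum_le p alpha t : X_level mu alpha !=set0 ->
  H_mes mu p t supp = 0%E ->
  (mixed_spectrum mu alpha <= (inner alpha p + t)%:E)%E.
Proof.
move=> [x0 Xx0] H0; apply/lee_addgt0Pr => e e0; rewrite -EFinD.
set s := _ + e; have ts : inner alpha p + t < s by rewrite ltrDl.
pose Y m := X_level mu alpha `&` [set x | forall r, 0 < r < m.+1%:R^-1 ->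
  (((2 * r) `^ s)%:E <= ball_pow mu p x r * ((2 * r) `^ t)%:E)%E].
have XY x : X_level mu alpha x -> exists m, Y m x.
  move=> Xx; have /near_right0P[rho rho0 rhoP] := level_set_ball_term_ge Xx ts.
  have [m mrho] := ltr_add_invr rho0 (y := 0); rewrite add0r in mrho.
  exists m; split=> // r /andP[r0 rm]; apply: rhoP.
  by rewrite r0 (lt_trans rm).
have HY m : H_bar mu p t (Y m) = 0%E.
  apply/eqP; rewrite eq_le H_bar_ge0 andbT -H0; apply: H_bar_le_mes.
  by move=> x [[[Sx _] _] _].
(* Hausdorff exponents are nonnegative.  If [s] were negative, every ball of a
   covering of the nonempty set [Y m] would have weight at least 1. *)
have s0 : 0 <= s.
  rewrite leNgt; apply/negP => s_lt0; have [m Yx0] := XY x0 Xx0.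
  have e10 : 0 < Num.min m.+1%:R^-1 2^-1 :> R by rewrite lt_min !invr_gt0 !ltr0n.
  have /H_bar_eq0P/(_ _ 2^-1 e10) := HY m.
  rewrite invr_gt0 ltr0n => /(_ isT)[I [x [r [[xr cov] sumle]]]].
  have [i Ii _] := cov x0 Yx0; have [[_ Yx] /andP[ri0]] := xr i Ii.
  rewrite lt_min => /andP[rim ri2].
  have : (1 <= ball_sum mu p t I x r)%E.
    apply: esum_ge; exists [set i]; first by split=> // _ ->.
    rewrite fsbig_set1; apply: le_trans (Yx (r i) _); last by rewrite ri0.
    rewrite lee_fin /powR gt_eqF ?mulr_gt0// -[leLHS]expR0 ler_expR.
    rewrite nmulr_rge0// ln_le0//.
    by rewrite -ler_pdivlMl// mulr1 ltW.
  move=> /le_trans/(_ sumle); apply/negP; rewrite lee_fin -ltNge.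
  by rewrite invf_lt1// ltr1n.
apply: ge_ereal_inf; exists s%:E => //; exists s => //; split=> //.
apply/hausdorff_measure_eq0P => delta eta delta0 eta0.
have : forall m, exists I_z : set nat * (nat -> 'rV[R]_d * R),
    [/\ Y m `<=` \bigcup_(i in I_z.1) eball (I_z.2 i).1 (I_z.2 i).2,
     forall i, I_z.1 i -> (ediam (eball (I_z.2 i).1 (I_z.2 i).2) <= delta%:E)%E &
    (\esum_(i in I_z.1) poweR (ediam (eball (I_z.2 i).1 (I_z.2 i).2)) s
       <= (eta / (2 ^ m.+1)%:R)%:E)%E].
  move=> m; have e10 : 0 < Num.min m.+1%:R^-1 (delta / 2) :> R.
    by rewrite lt_min invr_gt0 ltr0n divr_gt0.
  have e20 : 0 < eta / (2 ^ m.+1)%:R by rewrite divr_gt0// ltr0n expn_gt0.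
  have /H_bar_eq0P/(_ _ _ e10 e20)[I [x [r [[xr cov] sumle]]]] := HY m.
  exists (I, fun i => (x i, r i)); split=> //=.
    move=> i /xr[_ /andP[ri0]]; rewrite lt_min => /andP[_ rid].
    apply: le_trans (ediam_eball_le _ (ltW ri0)) _.
    by move: rid; rewrite ltr_pdivlMr// mulrC lee_fin => /ltW.
  apply: le_trans sumle; apply: le_esum => i /xr[[_ Yx] /andP[ri0]].
  rewrite lt_min => /andP[rim _]; apply: le_trans (Yx _ _); last by rewrite ri0.
  rewrite -poweR_EFin; apply: gt0_ler_poweR => //.
  - by rewrite in_itv/= leey andbT ediam_ge0.
  - by rewrite in_itv/= leey andbT lee_fin mulr_ge0// ltW.
  - exact/ediam_eball_le/ltW.
move=> /choice[f fP].
have [||I [z [sumz zP Iz]]] := @merge_families _ _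
  (fun A : set 'rV[R]_d => poweR (ediam A) s) (fun m => (f m).1)
  (fun m i => eball ((f m).2 i).1 ((f m).2 i).2) eta _ (ltW eta0).
- by move=> A; exact: poweR_ge0.
- by move=> m; have [] := fP m.
exists I, z; split=> //.
  move=> x /XY[m Yx]; have [cov _ _] := fP m; have [i fi xi] := cov x Yx.
  by have [l Il zl] := Iz m i fi; exists l; rewrite ?zl.
by move=> l /zP[m [i [fi ->]]]; have [_ diam _] := fP m; exact: diam.
Qed.

Variable nu : probability (borel_space R d) R.

(** By the Gibbs relation, the logarithm of [nu (eball x r)] is at most
    [beta + t] times [ln r], up to small multiples of [ln r] and a constant. *)
Lemma gibbs_decay q t beta x : gibbs_scaling mu nu q t -> supp x ->
  (forall e, 0 < e -> \forall r \near 0^'+,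
    inner q (log_masses mu x r) <= (beta - e) * ln r) ->
  forall s, s < beta + t ->
  \forall r \near 0^'+, (nu (eball x r) <= (r `^ s)%:E)%E.
Proof.
move=> gibbs Sx qL s sbt; pose e := (beta + t - s) / 3.
have e0 : 0 < e by rewrite divr_gt0// subr_gt0.
have [rho rho0 H] := gibbs e e0.
have Hq := qL e e0.
have se : s < beta - e + (t - e) by rewrite /e; lra.
near=> r.
have r0 : 0 < r by near: r; exact: nbhs_right_gt.
have rrho : r < rho by near: r; exact: nbhs_right_lt.
have rr : 0 < r < rho by rewrite r0.
have [_ nu0] := H x r Sx rr; rewrite ler_norml => /andP[_ h].
have hq : inner q (log_masses mu x r) <= (beta - e) * ln r by near: r.
rewrite ball_nuE lee_fin /powR gt_eqF// -[leLHS]lnK ?posrE// ler_expR.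
apply: (@le_trans _ _ ((beta - e + (t - e)) * ln r + (t - e) * ln 2)).
  by rewrite lnM ?posrE// in h; lra.
by near: r; exact: near_ln_absorb.
Unshelve. all: by end_near. Qed.

End level_sets.

(** * Gradients and the main theorem *)
Section gradients.
Context {R : realType} {k : nat}.
Variable C : 'rV[R]_k -> R^o.
Hypothesis diffC : differentiable C 0.

Let derive_quotientE (j : 'I_k) :
  (fun h => h^-1 *: ((C \o shift 0) (h *: delta_mx 0 j) - C 0)) =
  (diff_quotient C 0 j : R -> R^o).
Proof.
by apply/funext => h; rewrite /diff_quotient /= addr0 add0r; exact: mulrC.
Qed.

Let diff_quotient_cvg (j : 'I_k) :
  cvg ((diff_quotient C 0 j : R -> R^o) @ 0^').
Proof.
by rewrite -derive_quotientE; exact: (diff_derivable (v := delta_mx 0 j) diffC).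
Qed.

Lemma right_grad_diff : right_grad C 0 = grad C 0.
Proof.
apply/rowP => j; rewrite !mxE /derive derive_quotientE.
by rewrite (cvg_at_rightE (diff_quotient C 0 j : R -> R^o)).
Qed.

Lemma left_grad_diff : left_grad C 0 = grad C 0.
Proof.
apply/rowP => j; rewrite !mxE /derive derive_quotientE.
by rewrite (cvg_at_leftE (diff_quotient C 0 j : R -> R^o)).
Qed.

End gradients.

Lemma not_negligible_full (R : realType) (d : nat)
  (nu : probability (borel_space R d) R) (S X : set 'rV[R]_d) :
  nu S = 1%E -> measurable (S : set (borel_space R d)) ->
  nu.-negligible (S `\` X) -> ~ nu.-negligible X.
Proof.
move=> nuS1 mS negD negX; have : nu S = 0%E.
  apply: measure_negligible => //; apply: negligibleS (negligibleU negX negD).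
  by move=> x Sx; have [Xx|nXx] := pselect (X x); [left|right].
by rewrite nuS1 => /eqP; rewrite onee_eq0.
Qed.

Theorem theorem6p1 (R : realType) (d k : nat)
  (d_ge1 : (1 <= d)%N) (k_ge1 : (1 <= k)%N)
  (mu : 'I_k -> probability (borel_space R d) R)
  (q : 'rV[R]_k) (t_q r_q K_lower K_upper : R)
  (r_q_gt0 : 0 < r_q) (K_lower_gt0 : 0 < K_lower) (K_upper_gt0 : 0 < K_upper)
  (nu : probability (borel_space R d) R)
  (nu_supported : nu (~` mixed_support mu) = 0%E)
  (phi : R -> R^o) (phi_littleo : phi =o_ (0^'+) (@ln R : R -> R^o))
  (r_ : nat -> R)
  (r_in01 : forall n, 0 < r_ n < 1)
  (r_decr : forall m n, (m <= n)%N -> r_ n <= r_ m)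
  (r_to0 : r_ n @[n --> \oo] --> (0 : R))
  (r_ratio : ln (r_ n.+1) / ln (r_ n) @[n --> \oo] --> (1 : R))
  (r_summable : forall eps : R, 0 < eps -> cvgn (series (fun n => r_ n `^ eps)))
  (A1 : forall (x : 'rV[R]_d) (r : R), mixed_support mu x -> 0 < r < r_q ->
     K_lower <= fine (nu (eball x r)) /
       (fine (ball_pow mu q x r) * (2 * r) `^ t_q * expR (phi r)) <= K_upper)
  (C : 'rV[R]_k -> R^o)
  (A2 : forall p : 'rV[R]_k,
     log_moment mu nu (r_ n) p @[n --> \oo] --> (C p)%:E) :
  let X := X_lower mu (- right_grad C 0) `&` X_upper mu (- left_grad C 0) in
  (nonpos_vec q ->
     [/\ ((- inner (left_grad C 0) q)%:E + Lambda_dim mu q <= hausdorff_dim X)%E,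
         ((- inner (left_grad C 0) q)%:E + B_dim mu q <=
            (- inner (left_grad C 0) q)%:E + Lambda_dim mu q)%E &
         ((- inner (left_grad C 0) q)%:E + b_dim mu q <=
            (- inner (left_grad C 0) q)%:E + B_dim mu q)%E]) /\
  (nonneg_vec q ->
     [/\ ((- inner (right_grad C 0) q)%:E + Lambda_dim mu q <= hausdorff_dim X)%E,
         ((- inner (right_grad C 0) q)%:E + B_dim mu q <=
            (- inner (right_grad C 0) q)%:E + Lambda_dim mu q)%E &
         ((- inner (right_grad C 0) q)%:E + b_dim mu q <=
            (- inner (right_grad C 0) q)%:E + B_dim mu q)%E]) /\
  (differentiable C 0 ->
     [/\ mixed_spectrum mu (- grad C 0) = legendre (b_dim mu) (- grad C 0),
         legendre (b_dim mu) (- grad C 0) = legendre (B_dim mu) (- grad C 0) &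
         legendre (B_dim mu) (- grad C 0) =
           legendre (Lambda_dim mu) (- grad C 0)]).
Proof.
move=> X.
have Gibbs : gibbs_scaling mu nu q t_q.
  exact: (gibbs_scalingP r_q_gt0 K_lower_gt0 K_upper_gt0 phi_littleo A1).
have nuS1 := nu_support1 nu_supported.
have mS := measurable_mixed_support mu.
have Xfull : ~ nu.-negligible X.
  apply: not_negligible_full nuS1 mS _.
  exact: (grad_level_set_full nu_supported r_in01 r_decr r_to0 r_ratio
    r_summable A2).
have dim_ge beta : (forall x, X x -> forall e, 0 < e -> \forall r \near 0^'+,
      inner q (log_masses mu x r) <= (beta - e) * ln r) ->
    ((beta + t_q)%:E <= hausdorff_dim X)%E.
  move=> qL; apply: hausdorff_dim_ge Xfull _ => x s Xx sbt.
  by apply: gibbs_decay Gibbs _ (qL x Xx) s sbt; have [[]] := Xx.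
have bB p := b_le_B mu p d_ge1.
have BL p := B_le_Lambda mu p.
have Lt := Lambda_le_gibbs Gibbs.
have tb := b_ge_gibbs nu_supported Gibbs.
have LambdaE : Lambda_dim mu q = t_q%:E.
  apply/eqP; rewrite eq_le Lt /=.
  exact: le_trans tb (le_trans (bB q) (BL q)).
split; [|split].
- move=> q0; split; rewrite ?leeD2l//; rewrite LambdaE -EFinD.
  rewrite -innerNl innerC; apply: dim_ge => x [_ [_ upper]].
  by apply: inner_log_masses_le => j; right.
- move=> q0; split; rewrite ?leeD2l//; rewrite LambdaE -EFinD.
  rewrite -innerNl innerC; apply: dim_ge => x [[_ lower] _].
  by apply: inner_log_masses_le => j; left.
move=> diffC; set alpha := - grad C 0.
have Xalpha : X = X_level mu alpha.
  by rewrite /X right_grad_diff// left_grad_diff.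
have Xn0 : X_level mu alpha !=set0.
  rewrite -Xalpha; apply/set0P/eqP => X0; apply: Xfull; rewrite X0.
  exact: negligible_set0.
have lower : ((inner alpha q + t_q)%:E <= mixed_spectrum mu alpha)%E.
  rewrite /mixed_spectrum -Xalpha innerC; apply: dim_ge => x.
  rewrite Xalpha => -[[_ lower] [_ upper]]; apply: inner_log_masses_le => j.
  by have [q0|/ltW q0] := leP 0 (q 0 j); [left|right].
have upper p : (mixed_spectrum mu alpha <= (inner alpha p)%:E + b_dim mu p)%E.
  have le_t t : (b_dim mu p < t%:E)%E ->
      (mixed_spectrum mu alpha <= (inner alpha p + t)%:E)%E.
    by move=> /(b_dimP mu p t).2; exact: mixed_spectrum_le.
  move: le_t; case: (b_dim mu p) => [b| |] le_t; last 2 first.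
  - by rewrite leey.
  - rewrite leeNy_eq; apply/eqP/eq_ninfty => t.
    have := le_t (t - inner alpha p); rewrite ltNyr => /(_ isT).
    by rewrite addrC subrK.
  - apply/lee_addgt0Pr => e e0; rewrite -EFinD -addrA; apply: le_t.
    by rewrite lte_fin ltrDl.
have spectrumE g : (forall p, b_dim mu p <= g p)%E -> (g q <= t_q%:E)%E ->
    legendre g alpha = mixed_spectrum mu alpha.
  move=> bg gt; apply/eqP; rewrite eq_le; apply/andP; split.
    apply: ge_ereal_inf; exists ((inner alpha q)%:E + g q)%E; first by exists q.
    by apply: le_trans lower; rewrite EFinD leeD2l.
  apply: le_ereal_inf_tmp => _ [p _ <-]; apply: le_trans (upper p) _.
  by rewrite leeD2l.
have specb : legendre (b_dim mu) alpha = mixed_spectrum mu alpha.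
  apply: spectrumE => [p|]; first exact: lexx.
  exact: le_trans (bB q) (le_trans (BL q) Lt).
have specB : legendre (B_dim mu) alpha = mixed_spectrum mu alpha.
  by apply: spectrumE => [p|]; [exact: bB|exact: le_trans (BL q) Lt].
have specL : legendre (Lambda_dim mu) alpha = mixed_spectrum mu alpha.
  by apply: spectrumE => [p|]; [exact: le_trans (bB p) (BL p)|exact: Lt].
by rewrite specb specB specL.
Qed.
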